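(* Let $(X,\rho)$ be a geometrically doubling quasi-metric space and suppose $\mu$ is a positive Borel measure on $X$ with the property that $\mu(B)<\infty$ for all balls $B\subseteq X$. Let $\mathscr D=\bigcup_k\mathscr D_k$ be a system of dyadic cubes on $X$ with the distinguished center point property, and let $h^Q_u$ ($Q\in\mathscr D$, $u=0,\dots,M_Q-1$) be the associated Haar functions. For $1<p<\infty$, for each $f\in L^p(X,\mu)$, and for each $m\in\mathbb Z$, we have $$f(x)=\sum_{k\ge m}\sum_{Q\in\mathscr D_k}\sum_{u=1}^{M_Q-1}\langle f,h^Q_u\rangle h^Q_u(x)+\sum_{Q\in\mathscr D_m}\langle f,h^Q_0\rangle h^Q_0(x),$$ where the first sum converges both in the $L^p(X,\mu)$-norm and pointwise $\mu$-a.e. For the second sum we have $$\sum_{Q\in\mathscr D_m}\langle f,h^Q_0\rangle h^Q_0(x)\to\begin{cases}0,&\text{as }m\to-\infty\text{ if }\mu(X)=\infty;\\[2pt]\frac1{\mu(X)}\int_Xf\,d\mu,&\text{as }m\to-\infty\text{ if }\mu(X)<\infty.\end{cases}$$ As a consequence, $$f(x)=m_X(f)+\sum_{Q\in\mathscr D}\sum_{u=1}^{M_Q-1}\langle f,h^Q_u\rangle h^Q_u(x).$$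
   Context: **Setting.** A quasi-metric on $X$ is a map $\rho:X\times X\to[0,\infty)$ which is symmetric, vanishes exactly on the diagonal, and satisfies $\rho(x,y)\le A_0[\rho(x,z)+\rho(z,y)]$ with a constant $A_0\ge1$. It is geometrically doubling if there is $A_1\in\mathbb N$ such that every ball $B(x,r)=\{y:\rho(x,y)<r\}$ can be covered by at most $A_1$ balls of radius $r/2$. A set is open if with each point it contains a ball centred at that point; measurability is with respect to the Borel $\sigma$-algebra, which is assumed to contain all balls. The measure $\mu$ is not assumed to be doubling. **Dyadic cubes.** A system of dyadic cubes with parameters $\delta\in(0,1)$, $0<c_1\le C_1<\infty$ is a countable family $\mathscr D=\bigcup_{k\in\mathbb Z}\mathscr D_k$, $\mathscr D_k=\{Q^k_\alpha:\alpha\in\mathscr A_k\}$, of Borel sets (a cube is understood together with its generation $k$) with: $X=\bigcup_\alpha Q^k_\alpha$ (disjoint union) for each $k$; if $\ell\ge k$ then either $Q^\ell_\beta\subseteq Q^k_\alpha$ or $Q^k_\alpha\cap Q^\ell_\beta=\emptyset$; for each $(k,\alpha)$ and $\ell\le k$ there is a unique $\beta$ with $Q^k_\alpha\subseteq Q^\ell_\beta$; each $Q^k_\alpha$ is the union of the cubes of $\mathscr D_{k+1}$ it contains, whose number is between $1$ and a fixed constant $M$; there are center points $x^k_\alpha\in Q^k_\alpha$ with $B(x^k_\alpha,c_1\delta^k)\subseteq Q^k_\alpha\subseteq B(x^k_\alpha,C_1\delta^k)=:B(Q^k_\alpha)$; and if $\ell\ge k$ and $Q^\ell_\beta\subseteq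 Q^k_\alpha$ then $B(Q^\ell_\beta)\subseteq B(Q^k_\alpha)$. Distinguished center point property: there is $x_0\in X$ such that for every $k\in\mathbb Z$ there is $\alpha$ with $x_0=x^k_\alpha$. **Haar functions.** For $Q\in\mathscr D_k$ let $\mathrm{Ch}(Q)=\{R\in\mathscr D_{k+1}:R\subseteq Q\}$, $M_Q=\#\mathrm{Ch}(Q)$, and index the children as $Q_1,\dots,Q_{M_Q}$ so that $\sum_{j=u}^{M_Q}\mu(Q_j)\ge[1-(u-1)M_Q^{-1}]\mu(Q)$ for $u=1,\dots,M_Q$ (always possible, e.g. by increasing measure). Put $E_u=\bigcup_{j=u}^{M_Q}Q_j$. Then $h^Q_0=\mu(Q)^{-1/2}1_Q$ (terms $\langle f,h^Q_0\rangle h^Q_0$ with $\mu(Q)=0$ being taken to be $0$), and for $u=1,\dots,M_Q-1$: $h^Q_u=0$ if $\mu(Q_u)=0$, and otherwise $$h^Q_u=\frac{\mu(E_{u+1})^{1/2}}{\mu(Q_u)^{1/2}\mu(E_u)^{1/2}}1_{Q_u}-\frac{\mu(Q_u)^{1/2}}{\mu(E_u)^{1/2}\mu(E_{u+1})^{1/2}}1_{E_{u+1}}.$$ **Notation.** $\langle f,g\rangle=\int fg\,d\mu$. $m_X(f)=\frac1{\mu(X)}\int_Xf\,d\mu$ if $\mu(X)<\infty$ and $m_X(f)=0$ if $\mu(X)=\infty$. *)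

(* Defs.v *)
From HB Require Import structures.
From mathcomp Require Import all_boot all_order all_algebra finmap.
From mathcomp Require Import all_classical all_reals all_analysis.
From mathcomp Require summability.

Set Implicit Arguments.
Unset Strict Implicit.
Unset Printing Implicit Defensive.

Import Order.TTheory GRing.Theory Num.Theory.
Import numFieldNormedType.Exports.

Local Open Scope classical_set_scope.
Local Open Scope ring_scope.

Section quasi_metric.
Context {R : realType} {X : choiceType}.
Implicit Type rho : X -> X -> R.

Definition quasi_metric rho : Prop :=
  [/\ forall x y, 0 <= rho x y,
      forall x y, rho x y = rho y x,
      forall x y, rho x y = 0 <-> x = y &
      exists2 A0 : R, 1 <= A0 &
        forall x y z, rho x y <= A0 * (rho x z + rho z y)].

Definition qball rho (x : X) (r : R) : set X := [set y | rho x y < r].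

Definition qopen rho (U : set X) : Prop :=
  forall x, U x -> exists2 r : R, 0 < r & qball rho x r `<=` U.

Definition geometrically_doubling rho : Prop :=
  exists A1 : nat, forall (x : X) (r : R), 0 < r ->
    exists2 s : {fset X}, (#|` s| <= A1)%N &
      qball rho x r `<=` \bigcup_(z in [set` s]) qball rho z (r / 2).

End quasi_metric.

Definition borel_space {R : realType} {d} {X : measurableType d}
    (rho : X -> X -> R) : Prop :=
  (@measurable d X = <<s [set U | qopen rho U] >>) /\
  (forall x r, measurable (qball rho x r)).

(* A cube is given by its generation k together with an index in dy_idx k, so
   that the same subset of X may occur as a cube of several generations. *)
Record dyadic_system {R : realType} {d} {X : measurableType d}
    (rho : X -> X -> R) := DyadicSystem {
  dy_delta : R;
  dy_c1 : R;
  dy_C1 : R;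
  dy_M : nat;
  dy_idx : int -> countType;
  dy_cube : forall k : int, dy_idx k -> set X;
  dy_center : forall k : int, dy_idx k -> X;
  dy_delta_in : 0 < dy_delta < 1;
  dy_c1_C1 : 0 < dy_c1 <= dy_C1;
  dy_measurable : forall k (a : dy_idx k), measurable (dy_cube a);
  dy_cover : forall k, \bigcup_(a : dy_idx k) dy_cube a = setT;
  dy_disjoint : forall k (a b : dy_idx k),
    a != b -> dy_cube a `&` dy_cube b = set0;
  dy_nested : forall k l (a : dy_idx k) (b : dy_idx l), k <= l ->
    dy_cube b `<=` dy_cube a \/ dy_cube a `&` dy_cube b = set0;
  dy_ancestor : forall k l (a : dy_idx k), l <= k ->
    exists! b : dy_idx l, dy_cube a `<=` dy_cube b;
  dy_union : forall k (a : dy_idx k), dy_cube a =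
    \bigcup_(b in [set b : dy_idx (k + 1) | dy_cube b `<=` dy_cube a]) dy_cube b;
  dy_children_finite : forall k (a : dy_idx k),
    finite_set [set b : dy_idx (k + 1) | dy_cube b `<=` dy_cube a];
  dy_children_card : forall k (a : dy_idx k),
    (1 <= #|` fset_set [set b : dy_idx (k + 1) | dy_cube b `<=` dy_cube a]|
       <= dy_M)%N;
  dy_center_in : forall k (a : dy_idx k), dy_cube a (dy_center a);
  dy_ball_sub : forall k (a : dy_idx k),
    qball rho (dy_center a) (dy_c1 * dy_delta ^ k) `<=` dy_cube a;
  dy_sub_ball : forall k (a : dy_idx k),
    dy_cube a `<=` qball rho (dy_center a) (dy_C1 * dy_delta ^ k);
  dy_balls_nested : forall k l (a : dy_idx k) (b : dy_idx l), k <= l ->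
    dy_cube b `<=` dy_cube a ->
    qball rho (dy_center b) (dy_C1 * dy_delta ^ l) `<=`
    qball rho (dy_center a) (dy_C1 * dy_delta ^ k)
}.

Section haar.
Context {R : realType} {d} {X : measurableType d} {rho : X -> X -> R}.
Variable D : dyadic_system rho.
Implicit Type k : int.

Definition distinguished_center_point : Prop :=
  exists x0 : X, forall k, exists a : dy_idx D k, x0 = dy_center a.

Definition children k (a : dy_idx D k) : set (dy_idx D (k + 1)) :=
  [set b | dy_cube b `<=` dy_cube a].

Definition nchildren k (a : dy_idx D k) : nat := #|` fset_set (children a)|.

Variable mu : {measure set X -> \bar R}.

(* ch a u is the u-th child Q_u of the cube Q indexed by a, 1 <= u <= M_Q;
   the values of ch a at other u play no role. *)
Definition haar_ordering
    (ch : forall k, dy_idx D k -> nat -> dy_idx D (k + 1)) : Prop :=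
  forall k (a : dy_idx D k),
    set_bij [set u | (1 <= u <= nchildren a)%N] (children a) (ch k a) /\
    forall u : nat, (1 <= u <= nchildren a)%N ->
      ((1 - u.-1%:R / (nchildren a)%:R)%:E * mu (dy_cube a) <=
       \sum_(u <= j < (nchildren a).+1) mu (dy_cube (ch k a j)))%E.

Variable ch : forall k, dy_idx D k -> nat -> dy_idx D (k + 1).

Definition child_tail k (a : dy_idx D k) (u : nat) : set X :=
  \bigcup_(j in [set j | (u <= j <= nchildren a)%N]) dy_cube (ch a j).

Let sqmu (A : set X) : R := Num.sqrt (fine (mu A)).

(* When mu(Q) = 0 the convention 0^-1 = 0 gives h_0 = 0, so that the
   corresponding term of a Haar expansion vanishes. *)
Definition haar k (a : dy_idx D k) (u : nat) (x : X) : R :=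
  if u == 0%N then (sqmu (dy_cube a))^-1 * \1_(dy_cube a) x
  else if mu (dy_cube (ch a u)) == 0%E then 0
  else sqmu (child_tail a u.+1)
         / (sqmu (dy_cube (ch a u)) * sqmu (child_tail a u))
         * \1_(dy_cube (ch a u)) x
       - sqmu (dy_cube (ch a u))
         / (sqmu (child_tail a u) * sqmu (child_tail a u.+1))
         * \1_(child_tail a u.+1) x.

Definition pairing (f g : X -> R) : R := \int[mu]_x (f x * g x).

Definition haar_cube (f : X -> R) k (a : dy_idx D k) (x : X) : R :=
  \sum_(1 <= u < nchildren a) pairing f (haar a u) * haar a u x.

(* In the next two definitions at most one term is nonzero at a given x, since
   the cubes of one generation are disjoint and the summand of index a vanishes
   off dy_cube a; hence the finitely supported sum is the actual sum. *)
Definition haar_layer (f : X -> R) k (x : X) : R :=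
  \sum_(a \in [set: dy_idx D k]) haar_cube f a x.

Definition haar_average (f : X -> R) k (x : X) : R :=
  \sum_(a \in [set: dy_idx D k]) pairing f (haar a 0%N) * haar a 0%N x.

End haar.

Definition space_mean {R : realType} {d} {X : measurableType d}
    (mu : {measure set X -> \bar R}) (f : X -> R) : R :=
  if mu setT == +oo%E then 0 else (fine (mu setT))^-1 * \int[mu]_x f x.

Definition cvg_Lp {R : realType} {d} {X : measurableType d}
    (mu : {measure set X -> \bar R}) (p : R) {I : Type} (F : set_system I)
    (u : I -> X -> R) (l : X -> R) : Prop :=
  [/\ forall i, u i \in Lfun mu p%:E,
      l \in Lfun mu p%:E &
      ('N[mu]_p%:E[EFin \o (u i \- l)%R])%E @[i --> F] --> 0%E].

(* Main.v *)
Require Import Defs.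
From mathcomp Require Import all_boot all_order all_algebra finmap.
From mathcomp Require Import all_classical all_reals all_analysis.
From mathcomp Require summability.
From mathcomp Require Import measurable_realfun ring lra.

Import Order.TTheory GRing.Theory Num.Theory.
Import numFieldNormedType.Exports.
Local Open Scope classical_set_scope.
Local Open Scope ring_scope.

(* For [x] in X let E_k f (x) be the mean of f over the generation-k cube that
   contains x. Since the mean over E_u is a convex combination of the means
   over Q_u and E_(u+1), the u-th Haar term on a cube is the change of the mean
   when E_u is split into Q_u and E_(u+1); these changes telescope, so off the
   null cubes the layer of generation k is E_(k+1) f - E_k f, and everything
   reduces to martingale convergence of E_k f as k -> +oo and k -> -oo.
   - k -> +oo, almost everywhere: the sets approximable in measure, inside a
     fixed cube, by unions of cubes of one generation form a sigma-algebra
     containing the open sets, so functions constant on the cubes of some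
     generation are dense in L^1; the weak (1,1) inequality for the dyadic
     maximal function (first-passage decomposition) then applies.
   - In L^p: by Jensen every E_k is a contraction, and dominated convergence
     settles bounded functions supported on finitely many cubes.
   - k -> -oo: the cubes containing the distinguished point x0 increase to X,
     so the means stabilise to the mean over X; when mu(X) = +oo they vanish by
     Jensen, and (p > 1) the L^p norm of a mean times an indicator,
     |c| mu(Q)^(1/p - 1), tends to 0. *)

(** * Dyadic sets and functions *)

Section dyadic_cubes.
Set Implicit Arguments.
Unset Strict Implicit.
Context {R : realType} {d} {X : measurableType d} {rho : X -> X -> R}.
Variable D : dyadic_system rho.
Implicit Types (k l : int) (A B : set X).

Lemma cube_at_ex k x : exists a : dy_idx D k, dy_cube a x.
Proof.
have : [set: X] x by [].
by rewrite -(dy_cover D k) => -[a _ ax]; exists a.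
Qed.

Definition cube_at k x : dy_idx D k := projT1 (cid (cube_at_ex k x)).

Lemma cube_atP k x : dy_cube (cube_at k x) x.
Proof. exact: (projT2 (cid (cube_at_ex k x))). Qed.

Lemma cube_at_eq k (a : dy_idx D k) x : dy_cube a x -> cube_at k x = a.
Proof.
move=> ax; apply/eqP/negP => /negP /dy_disjoint H.
have : (dy_cube (cube_at k x) `&` dy_cube a) x by split => //; exact: cube_atP.
by rewrite H.
Qed.

Lemma cube_at_sub k l x : k <= l ->
  dy_cube (cube_at l x) `<=` dy_cube (cube_at k x).
Proof.
move=> kl; have [//|H] := dy_nested (cube_at k x) (cube_at l x) kl.
have : (dy_cube (cube_at k x) `&` dy_cube (cube_at l x)) x.
  by split; exact: cube_atP.
by rewrite H.
Qed.

Lemma cube_at_coarser k l x y : k <= l ->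
  cube_at l x = cube_at l y -> cube_at k x = cube_at k y.
Proof.
move=> kl xy; apply/esym/cube_at_eq.
by apply: (cube_at_sub kl); rewrite xy; exact: cube_atP.
Qed.

(** Unions of cubes of generation [k], encoded as saturation under the relation of lying in the same
    cube, so that Boolean operations need no choice of the cubes involved. *)
Definition dyadic_set k A : Prop :=
  forall x y, cube_at k x = cube_at k y -> A x -> A y.

Lemma dyadic_set_finer k l A : k <= l -> dyadic_set k A -> dyadic_set l A.
Proof. by move=> kl kA x y xy; apply: kA; exact: cube_at_coarser xy. Qed.

Lemma dyadic_setC k A : dyadic_set k A -> dyadic_set k (~` A).
Proof. by move=> kA x y xy Ax Ay; apply: Ax; exact: kA Ay. Qed.

Lemma dyadic_setU k A B :
  dyadic_set k A -> dyadic_set k B -> dyadic_set k (A `|` B).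
Proof.
move=> kA kB x y xy [Ax|Bx]; [left; exact: kA Ax|right; exact: kB Bx].
Qed.

Lemma dyadic_setI k A B :
  dyadic_set k A -> dyadic_set k B -> dyadic_set k (A `&` B).
Proof. by move=> kA kB x y xy [Ax Bx]; split; [exact: kA Ax|exact: kB Bx]. Qed.

Lemma dyadic_set_cube k l (a : dy_idx D k) : k <= l ->
  dyadic_set l (dy_cube a).
Proof.
move=> kl x y /(cube_at_coarser kl) xy /cube_at_eq <-.
by rewrite xy; exact: cube_atP.
Qed.

Lemma dyadic_set_capE k (a : dy_idx D k) A : dyadic_set k A ->
  A `&` dy_cube a = dy_cube a \/ A `&` dy_cube a = set0.
Proof.
move=> kA; have [Aa|Aa] := pselect (A (dy_center a)); [left|right].
  rewrite setIidr// => x ax; apply: kA Aa.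
  by rewrite !(@cube_at_eq _ a)//; exact: dy_center_in.
rewrite -subset0 => x [Ax ax]; apply: Aa; apply: kA Ax.
by rewrite !(@cube_at_eq _ a)//; exact: dy_center_in.
Qed.

(** Generation [k] enumerated by the codes of its countable index type, with the empty set at codes
    of no cube; results on sequences of disjoint sets then apply directly. *)
Definition cube_seq k (n : nat) : set X :=
  if pickle_inv n is Some a then @dy_cube _ _ _ _ D k a else set0.

Lemma cube_seqP k n :
  cube_seq k n = set0 \/ exists a : dy_idx D k, cube_seq k n = dy_cube a.
Proof.
by rewrite /cube_seq; case: pickle_inv => [a|]; [right; exists a|left].
Qed.

Lemma cube_seq_pickle k (a : dy_idx D k) : cube_seq k (choice.pickle a) = dy_cube a.
Proof. by rewrite /cube_seq pickleK_inv. Qed.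

Lemma cube_seq_cover k : \bigcup_n cube_seq k n = setT.
Proof.
rewrite -subTset => x _; exists (choice.pickle (cube_at k x)) => //.
by rewrite cube_seq_pickle; exact: cube_atP.
Qed.

Lemma trivIset_cube_seq k : trivIset setT (cube_seq k).
Proof.
move=> i j _ _ [x []]; rewrite /cube_seq.
case ei : (pickle_inv i) => [a|//]; case ej : (pickle_inv j) => [b|//].
move=> /cube_at_eq ax /cube_at_eq bx.
have := @pickle_invK (dy_idx D k) i; have := @pickle_invK (dy_idx D k) j.
by rewrite /ocancel ei ej /= -ax -bx => <- <-.
Qed.

Lemma measurable_cube_seq k n : measurable (cube_seq k n).
Proof. by case: (cube_seqP k n) => [->//|[a ->]]; exact: dy_measurable. Qed.

Lemma dyadic_set_cube_seq k n : dyadic_set k (cube_seq k n).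
Proof.
by case: (cube_seqP k n) => [->//|[a ->]]; exact: dyadic_set_cube.
Qed.

Lemma dyadic_set_bigcup (I : Type) (P : set I) k (F : I -> set X) :
  (forall i, P i -> dyadic_set k (F i)) ->
  dyadic_set k (\bigcup_(i in P) F i).
Proof. by move=> kF x y xy [i Pi Fx]; exists i => //; exact: kF Fx. Qed.

Lemma dyadic_set_decomp k A : A = \bigcup_n (A `&` cube_seq k n).
Proof. by rewrite -setI_bigcupr cube_seq_cover setIT. Qed.

Lemma dyadic_set_cap_seq k A n : dyadic_set k A ->
  A `&` cube_seq k n = set0 \/
  exists a : dy_idx D k, A `&` cube_seq k n = dy_cube a.
Proof.
move=> kA; case: (cube_seqP k n) => [->|[a ->]]; first by rewrite setI0; left.
by have [->|->] := dyadic_set_capE a kA; [right; exists a|left].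
Qed.

Lemma measurable_dyadic_set k A : dyadic_set k A -> measurable A.
Proof.
move=> kA; rewrite (dyadic_set_decomp k A).
apply: bigcup_measurable => n _.
by case: (dyadic_set_cap_seq n kA) => [->//|[a ->]]; exact: dy_measurable.
Qed.

Definition dyadic_fun k (g : X -> R) : Prop :=
  forall x y, cube_at k x = cube_at k y -> g x = g y.

Lemma dyadic_fun_preimage k (g : X -> R) (Y : set R) :
  dyadic_fun k g -> dyadic_set k (g @^-1` Y).
Proof. by move=> kg x y xy /=; rewrite (kg x y). Qed.

Lemma measurable_dyadic_fun k (g : X -> R) :
  dyadic_fun k g -> measurable_fun setT g.
Proof.
move=> kg _ Y mY; rewrite setTI.
exact: measurable_dyadic_set (@dyadic_fun_preimage _ _ Y kg).
Qed.

Lemma dyadic_fun_indic k A : dyadic_set k A -> dyadic_fun k (\1_A).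
Proof.
move=> kA x y xy; rewrite !indicE; congr (_%:R); congr nat_of_bool.
apply/idP/idP; rewrite !inE; first exact: kA.
by apply: kA.
Qed.

End dyadic_cubes.

(** * Means over cubes and the maximal inequality *)

Section conditional_expectation.
Set Implicit Arguments.
Unset Strict Implicit.
Context {R : realType} {d} {X : measurableType d} {rho : X -> X -> R}.
Variables (D : dyadic_system rho) (mu : {measure set X -> \bar R}).
Hypothesis cube_fin : forall k (a : dy_idx D k), (mu (dy_cube a) < +oo)%E.
Implicit Types (k l : int) (A B : set X) (f g : X -> R).

(** By the conventions for [fine] and the inverse, the mean is 0 over a set of measure 0 or
    [+oo]. *)
Definition mean (A : set X) f : R :=
  (fine (mu A))^-1 * \int[mu]_(y in A) f y.

Definition condexp k f (x : X) : R := mean (dy_cube (cube_at D k x)) f.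

Definition loc_int k f : Prop :=
  forall a : dy_idx D k, mu.-integrable (dy_cube a) (EFin \o f).

Lemma condexpE k f (a : dy_idx D k) x :
  dy_cube a x -> condexp k f x = mean (dy_cube a) f.
Proof. by move=> ax; rewrite /condexp (cube_at_eq ax). Qed.

Lemma dyadic_fun_condexp k f : dyadic_fun D k (condexp k f).
Proof. by move=> x y xy; rewrite /condexp xy. Qed.

Lemma measurable_condexp k f : measurable_fun setT (condexp k f).
Proof. exact: measurable_dyadic_fun (@dyadic_fun_condexp k f). Qed.

Lemma integrable_loc_int k f : mu.-integrable setT (EFin \o f) -> loc_int k f.
Proof.
move=> fi a; apply: integrableS fi => //; exact: dy_measurable.
Qed.

Lemma loc_int_measurable k f : loc_int k f -> measurable_fun setT f.
Proof.
move=> fi; rewrite -(cube_seq_cover D k).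
apply/measurable_fun_bigcup => [n|n]; first exact: measurable_cube_seq.
case: (cube_seqP D k n) => [->|[a ->]]; first exact: measurable_fun_set0.
by have /integrableP[/measurable_EFinP] := fi a.
Qed.

Lemma mean_ge0 A f : (forall x, A x -> 0 <= f x) -> 0 <= mean A f.
Proof.
move=> f0; apply: mulr_ge0; last exact: Rintegral_ge0.
by rewrite invr_ge0 fine_ge0.
Qed.

Lemma condexp_ge0 k f x : (forall x, 0 <= f x) -> 0 <= condexp k f x.
Proof. by move=> f0; apply: mean_ge0. Qed.

Lemma meanB A f g : measurable A -> mu.-integrable A (EFin \o f) ->
  mu.-integrable A (EFin \o g) -> mean A (f \- g) = mean A f - mean A g.
Proof. by move=> mA fi gi; rewrite /mean RintegralB// mulrBr. Qed.

Lemma ler_norm_mean A f : measurable A -> mu.-integrable A (EFin \o f) ->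
  `|mean A f| <= mean A (fun x => `|f x|).
Proof.
move=> mA fi; rewrite /mean normrM ger0_norm ?invr_ge0 ?fine_ge0//.
by rewrite ler_wpM2l ?invr_ge0 ?fine_ge0//; exact: le_normr_Rintegral.
Qed.

Lemma le_mean A f g : measurable A -> mu.-integrable A (EFin \o f) ->
  mu.-integrable A (EFin \o g) -> (forall x, A x -> f x <= g x) ->
  mean A f <= mean A g.
Proof.
move=> mA fi gi fg; rewrite /mean ler_wpM2l ?invr_ge0 ?fine_ge0//.
exact: le_Rintegral.
Qed.

Lemma mean_cst A f c : measurable A -> mu A != 0%E -> (mu A < +oo)%E ->
  (forall x, A x -> f x = c) -> mean A f = c.
Proof.
move=> mA A0 Aoo fc; rewrite /mean (@eq_Rintegral _ _ _ _ A (cst c)).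
  have mA0 : fine (mu A) != 0 by rewrite fine_eq0// ge0_fin_numE.
  by rewrite Rintegral_cst// mulrC -mulrA mulfV// mulr1.
by move=> x; rewrite inE; exact: fc.
Qed.

(** Clearing the denominator admits a null [A], for which both sides are 0. *)
Lemma mule_mean A f : measurable A -> (mu A < +oo)%E ->
  mu.-integrable A (EFin \o f) ->
  ((mean A f)%:E * mu A = \int[mu]_(x in A) (f x)%:E)%E.
Proof.
move=> mA Aoo fi.
have Af : mu A \is a fin_num by rewrite ge0_fin_numE.
have [A0|A0] := eqVneq (mu A) 0%E.
  by rewrite A0 mule0 null_set_integral//; case/integrableP: fi.
rewrite -{1}(fineK Af) /mean -EFinM mulrAC mulVf ?fine_eq0// mul1r.
by rewrite /Rintegral fineK//; exact: integrable_fin_num.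
Qed.

(** [B] splits into countably many cubes, on each of which [condexp k g] is the constant mean of
    [g]. Nonnegativity justifies the splitting, since [g] is integrable only cube by cube. *)
Lemma integral_condexp k g B : (forall x, 0 <= g x) -> loc_int k g ->
  dyadic_set D k B ->
  (\int[mu]_(x in B) (condexp k g x)%:E = \int[mu]_(x in B) (g x)%:E)%E.
Proof.
move=> g0 gi kB; have mB := measurable_dyadic_set kB.
rewrite (dyadic_set_decomp D k B).
have mBn n : measurable (B `&` cube_seq D k n).
  by apply: measurableI => //; exact: measurable_cube_seq.
have tB : trivIset setT (fun n => B `&` cube_seq D k n).
  exact/trivIset_setIl/trivIset_cube_seq.
rewrite !ge0_integral_bigcup//; last 4 first.
- apply/measurable_EFinP; apply: measurable_funTS.
  exact: loc_int_measurable gi.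
- by move=> x _; rewrite lee_fin.
- apply/measurable_EFinP; apply: measurable_funTS; exact: measurable_condexp.
- by move=> x _; rewrite lee_fin condexp_ge0.
apply: eq_eseriesr => n _.
case: (dyadic_set_cap_seq n kB) => [->|[a ->]]; first by rewrite !integral_set0.
rewrite (eq_integral (cst (mean (dy_cube a) g)%:E)); last first.
  by move=> x; rewrite inE => ax; rewrite (condexpE _ ax).
have ma := @dy_measurable _ _ _ _ D k a.
by rewrite integral_cst// mule_mean.
Qed.

(* [B n] is the set where level [lam] is first exceeded at generation [k + n];
   it is a union of cubes of that generation. *)
Lemma weak_type k g (lam : R) : (forall x, 0 <= g x) ->
  mu.-integrable setT (EFin \o g) -> 0 < lam ->
  measurable [set x | exists n : nat, lam < condexp (k + n%:Z) g x] /\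
  (lam%:E * mu [set x | exists n : nat, (lam < condexp (k + n%:Z) g x)%R]
   <= \int[mu]_x (g x)%:E)%E.
Proof.
move=> g0 gi lam0; set W := [set x | _].
pose B (n : nat) := [set x | lam < condexp (k + n%:Z) g x /\
  forall j : nat, (j < n)%N -> condexp (k + j%:Z) g x <= lam].
have kB n : dyadic_set D (k + n%:Z) (B n).
  move=> x y xy [nx jx]; split.
    by rewrite -(@dyadic_fun_condexp _ g _ _ xy).
  move=> j jn; rewrite -(@dyadic_fun_condexp _ g x y) ?jx//.
  by apply: cube_at_coarser xy; rewrite lerD2l lez_nat ltnW.
have mB n : measurable (B n) by exact: measurable_dyadic_set (kB n).
have tB : trivIset setT B.
  have lt_disj i j x : (i < j)%N -> B i x -> B j x -> False.
    by move=> ij [ix _] [_ /(_ _ ij)]; rewrite leNgt ix.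
  move=> i j _ _ [x [Bi Bj]]; apply/eqP; rewrite eqn_leq; apply/andP; split.
    by rewrite leqNgt; apply/negP => ji; exact: lt_disj ji Bj Bi.
  by rewrite leqNgt; apply/negP => ij; exact: lt_disj ij Bi Bj.
have WB : W = \bigcup_n B n.
  apply/seteqP; split => [x [n nx]|x [n _ [nx _]]]; last by exists n.
  have [m mx mmin] := ex_minnP (ex_intro (fun n : nat => lam < condexp (k + n%:Z) g x) n nx).
  exists m => //; split => // j jm; rewrite leNgt; apply/negP => /mmin.
  by rewrite leqNgt jm.
split; first by rewrite WB; exact: bigcup_measurable.
have mg : measurable_fun setT (EFin \o g) by case/integrableP: gi.
(* It remains to bound [lam * mu W] by the integral over [W], which splits over the disjoint sets
   [B n]. *)
apply: (@le_trans _ _ (\int[mu]_(x in W) (g x)%:E)%E); last first.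
  apply: ge0_subset_integral => //.
  - by rewrite WB; exact: bigcup_measurable.
  - by move=> x _; rewrite lee_fin.
rewrite WB ge0_integral_bigcup//; last 2 first.
- exact: measurable_funTS.
- by move=> x _; rewrite lee_fin.
have := @measure_semi_sigma_additive _ _ _ mu B mB tB (bigcup_measurable (fun n _ => mB n)).
move=> /cvg_lim <-//.
rewrite -nneseriesZl//.
apply: lee_nneseries => [n _|n _]; first by rewrite mule_ge0// lee_fin ltW.
(* As [B n] is a union of cubes of generation [k + n], the function [g] may be replaced under the
   integral by its means, which exceed [lam] on [B n]. *)
have := @integral_condexp (k + n%:Z) g (B n) g0 (@integrable_loc_int _ _ gi) (kB n).
move=> <-.
rewrite -integral_cst//; apply: ge0_le_integral => //.
- by move=> x _; rewrite lee_fin ltW.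
- apply/measurable_EFinP; apply: measurable_funTS; exact: measurable_condexp.
- by move=> x [lx _]; rewrite lee_fin ltW.
Qed.

End conditional_expectation.

(** * Norm inequalities and dominated convergence in Lp *)

Section Lp_toolkit.
Set Implicit Arguments.
Unset Strict Implicit.
Context {R : realType} {d} {X : measurableType d}.
Variables (mu : {measure set X -> \bar R}) (p : R).
Hypothesis p1 : 1 <= p.
Implicit Types (u v w : X -> R).
Local Notation N u := ('N[mu]_p%:E[EFin \o u])%E.

Let p0 : 0 < p. Proof. exact: lt_le_trans p1. Qed.

Lemma LfunE u : u \in Lfun mu p%:E <-> measurable_fun setT u /\ (N u < +oo)%E.
Proof.
split; first by rewrite inE => /andP[]; rewrite !inE.
by move=> [mu_ Nu]; rewrite inE; apply/andP; split; rewrite inE.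
Qed.

Lemma Lfun_measurable u : u \in Lfun mu p%:E -> measurable_fun setT u.
Proof. by case/LfunE. Qed.

Lemma Lnorm_powR u : (N u = (\int[mu]_x (`|u x| `^ p)%:E) `^ p^-1)%E.
Proof. by rewrite unlock. Qed.

Lemma Lfun_powR u : u \in Lfun mu p%:E <->
  measurable_fun setT u /\ mu.-integrable setT (fun x => (`|u x| `^ p)%:E).
Proof.
split=> [uL|[mu_ ui]].
  by split; [case/LfunE: uL|exact: Lfun_integrable].
apply/LfunE; split => //; rewrite Lnorm_powR poweR_lty//.
by move/integrableP : ui => [_]; under eq_integral do rewrite gee0_abs ?lee_fin ?powR_ge0//.
Qed.

Lemma measurable_normr_powR (A : set X) u : measurable_fun A u ->
  measurable_fun A (fun x => (`|u x| `^ p)%:E).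
Proof.
move=> mu_; apply/measurable_EFinP.
apply: (measurableT_comp (measurable_powR _)) => //.
exact: measurableT_comp.
Qed.

Lemma LnormD_le u v : measurable_fun setT u -> measurable_fun setT v ->
  (N (fun x => u x + v x)%R <= N u + N v)%E.
Proof. by move=> mu_ mv; exact: minkowski_EFin. Qed.

Lemma LnormN u : (N (fun x => - u x)%R = N u)%E.
Proof. by rewrite -(oppe_Lnorm mu (EFin \o u)). Qed.

Lemma LnormB_le u v : measurable_fun setT u -> measurable_fun setT v ->
  (N (fun x => u x - v x)%R <= N u + N v)%E.
Proof.
move=> mu_ mv; rewrite -(LnormN v).
apply: (@LnormD_le u (fun x => - v x)) => //; exact: measurableT_comp.
Qed.

Lemma le_Lnorm_powR u v :
  (\int[mu]_x (`|u x| `^ p)%:E <= \int[mu]_x (`|v x| `^ p)%:E)%E ->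
  (N u <= N v)%E.
Proof.
move=> uv; rewrite (Lnorm_powR u) (Lnorm_powR v); apply: gt0_ler_poweR => //.
- by rewrite invr_ge0 ltW.
- by rewrite in_itv/= leey andbT integral_ge0// => x _; rewrite lee_fin powR_ge0.
- by rewrite in_itv/= leey andbT integral_ge0// => x _; rewrite lee_fin powR_ge0.
Qed.

Lemma le_Lnorm u v : measurable_fun setT u -> measurable_fun setT v ->
  (forall x, `|u x| <= `|v x|) -> (N u <= N v)%E.
Proof.
move=> mu_ mv uv; apply: le_Lnorm_powR.
apply: ge0_le_integral => //; [exact: measurable_normr_powR..|].
by move=> x _; rewrite lee_fin ge0_ler_powR// ?nnegrE// ltW.
Qed.

Lemma LnormZl c u : measurable_fun setT u ->
  (N (fun x => c * u x)%R = `|c|%:E * N u)%E.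
Proof.
move=> mu_; rewrite (Lnorm_powR u) (Lnorm_powR (fun _ => _)).
under eq_integral do rewrite normrM powRM// EFinM.
rewrite ge0_integralZl_EFin//; last exact: measurable_normr_powR.
rewrite poweRM ?lee_fin ?powR_ge0//; last first.
  by rewrite integral_ge0// => x _; rewrite lee_fin powR_ge0.
by rewrite poweR_EFin -powRrM mulfV ?gt_eqF// powRr1.
Qed.

Lemma Lfun_le u v : measurable_fun setT u -> v \in Lfun mu p%:E ->
  (forall x, `|u x| <= `|v x|) -> u \in Lfun mu p%:E.
Proof.
move=> mu_ /LfunE[mv Nv] uv; apply/LfunE; split=> //.
by apply: le_lt_trans Nv; exact: le_Lnorm.
Qed.

Lemma LfunD u v : u \in Lfun mu p%:E -> v \in Lfun mu p%:E ->
  (fun x => u x + v x) \in Lfun mu p%:E.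
Proof.
move=> /LfunE[mu_ Nu] /LfunE[mv Nv]; apply/LfunE; split.
  exact: measurable_funD.
by apply: le_lt_trans (LnormD_le mu_ mv) _; exact: lte_add_pinfty.
Qed.

Lemma LfunZl c u : u \in Lfun mu p%:E -> (fun x => c * u x) \in Lfun mu p%:E.
Proof.
move=> /LfunE[mu_ Nu]; apply/LfunE; split; first exact: measurable_funM.
by rewrite LnormZl// lte_mul_pinfty.
Qed.

Lemma LfunB u v : u \in Lfun mu p%:E -> v \in Lfun mu p%:E ->
  (fun x => u x - v x) \in Lfun mu p%:E.
Proof.
move=> uL vL; have -> : (fun x => u x - v x) = (fun x => u x + -1 * v x).
  by apply/funext => x; rewrite mulN1r.
exact: LfunD uL (LfunZl (-1) vL).
Qed.

Lemma Lnorm_ae_eq u v : measurable_fun setT u -> measurable_fun setT v ->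
  {ae mu, forall x, u x = v x} -> N u = N v.
Proof.
move=> mu_ mv uv; rewrite (Lnorm_powR u) (Lnorm_powR v).
suff -> : (\int[mu]_x (`|u x| `^ p)%:E = \int[mu]_x (`|v x| `^ p)%:E)%E by [].
apply: ae_eq_integral => //; [exact: measurable_normr_powR..|].
by apply: filterS uv => x -> _.
Qed.

Lemma Lfun_ae_eq u v : measurable_fun setT u -> v \in Lfun mu p%:E ->
  {ae mu, forall x, u x = v x} -> u \in Lfun mu p%:E.
Proof.
move=> mu_ /LfunE[mv Nv] uv; apply/LfunE; split => //.
by rewrite (Lnorm_ae_eq mu_ mv uv).
Qed.

Lemma Lnorm_le_powR u (e : R) : 0 <= e ->
  (\int[mu]_x (`|u x| `^ p)%:E <= (e `^ p)%:E)%E -> (N u <= e%:E)%E.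
Proof.
move=> e0 ue; rewrite Lnorm_powR.
rewrite -[e in leRHS]powRr1// -(mulfV (lt0r_neq0 p0)) powRrM -poweR_EFin.
apply: gt0_ler_poweR => //; first by rewrite invr_ge0 ltW.
  by rewrite in_itv/= leey andbT integral_ge0// => x _; rewrite lee_fin powR_ge0.
by rewrite in_itv/= leey andbT lee_fin powR_ge0.
Qed.

Lemma Lnorm_cvg0 {I : Type} (F : set_system I) {FF : Filter F} (u : I -> X -> R) :
  (forall e : R, 0 < e -> \forall i \near F, (N (u i) <= e%:E)%E) ->
  N (u i) @[i --> F] --> 0%E.
Proof.
move=> ue.
have fin : \forall i \near F, N (u i) \is a fin_num.
  apply: filterS (ue 1 ltr01) => i ui; rewrite ge0_fin_numE ?Lnorm_ge0//.
  exact: le_lt_trans ui (ltry _).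
apply/fine_cvgP; split => //; apply/cvgrPdist_le => e e0.
near=> i; rewrite sub0r normrN ger0_norm ?fine_ge0 ?Lnorm_ge0//.
rewrite -lee_fin fineK; last by near: i.
by near: i; exact: ue.
Unshelve. all: by end_near. Qed.

Lemma Lnorm_cvg0_le {I : Type} (F : set_system I) {FF : Filter F}
    (u : I -> X -> R) (e : R) : 0 < e ->
  N (u i) @[i --> F] --> 0%E -> (\forall i \near F, N (u i) <= e%:E)%E.
Proof.
move=> e0 /fine_cvgP[fin /cvgrPdist_le /(_ _ e0) le]; near=> i.
have Nf : (N (u i) \is a fin_num)%E by near: i.
rewrite -(fineK Nf) lee_fin.
have : `|0 - fine (N (u i))%E| <= e by near: i.
by rewrite sub0r normrN ger0_norm// fine_ge0// Lnorm_ge0.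
Unshelve. all: by end_near. Qed.

Lemma powR_cvg0 (s : nat -> R) : s n @[n --> \oo] --> (0 : R) ->
  `|s n| `^ p @[n --> \oo] --> (0 : R).
Proof.
move=> s0; apply/cvgrPdist_le => e e0.
have e1 : 0 < e `^ p^-1 by rewrite powR_gt0.
move/cvgrPdist_le : s0 => /(_ _ e1); apply: filterS => n.
rewrite !sub0r !normrN => se.
rewrite ger0_norm ?powR_ge0//.
have -> : e = (e `^ p^-1) `^ p by rewrite -powRrM mulVf ?gt_eqF// powRr1// ltW.
by rewrite ge0_ler_powR ?nnegrE// ltW.
Qed.

(** Dominated convergence for the p-th powers of [|u n|], with the p-th power of [|v|] as integrable
    bound. *)
Lemma Lnorm_dominated (u : nat -> X -> R) v :
  (forall n, measurable_fun setT (u n)) -> v \in Lfun mu p%:E ->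
  (forall n x, `|u n x| <= `|v x|) ->
  {ae mu, forall x, u n x @[n --> \oo] --> (0 : R)} ->
  N (u n) @[n --> \oo] --> 0%E.
Proof.
move=> mu_ /Lfun_powR[mv vi] uv u0.
have [] := @dominated_convergence _ X R mu setT measurableT
  (fun n x => (`|u n x| `^ p)%:E) (cst 0%E) (fun x => (`|v x| `^ p)%:E).
- by move=> n; exact: measurable_normr_powR.
- exact: measurable_cst.
- apply: filterS u0 => x ux _ /=; apply: cvg_EFin; first exact: nearW.
  exact: powR_cvg0.
- exact: vi.
- apply: aeW => x n _ /=; rewrite ger0_norm ?powR_ge0// lee_fin.
  by rewrite ge0_ler_powR// ?nnegrE// ltW.
move=> _ _; rewrite integral0 => /fine_cvgP[fin lim].
apply: Lnorm_cvg0 => e e0; have e1 : 0 < e `^ p by rewrite powR_gt0.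
move/cvgrPdist_le : lim => /(_ _ e1) lim; near=> n.
apply: Lnorm_le_powR; first exact: ltW.
have If : (\int[mu]_x (`|u n x| `^ p)%:E)%E \is a fin_num by near: n.
have : `|0 - fine (\int[mu]_x (`|u n x| `^ p)%:E)%E| <= e `^ p by near: n.
by rewrite -[X in (X <= _)%E](fineK If) lee_fin sub0r normrN => /(le_trans (ler_norm _)).
Unshelve. all: by end_near. Qed.

(** Of linearity only compatibility with differences is recorded: the density argument compares [u]
    with an approximant. *)
Definition Lp_contraction (T : (X -> R) -> X -> R) : Prop :=
  forall u v, u \in Lfun mu p%:E -> v \in Lfun mu p%:E ->
  [/\ T u \in Lfun mu p%:E, T (fun x => u x - v x) = (fun x => T u x - T v x)
    & (N (T u) <= N u)%E].

(** Density argument: [T n u - L u] is the sum of [(T n - L) (u - w j)] and [T n (w j) - L (w j)].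
    The first has norm at most twice that of [u - w j], uniformly in [n]; for fixed [j] the second
    tends to 0. This accounts for the three thirds of [e]. *)
Lemma Lp_contraction_cvg (T : nat -> (X -> R) -> X -> R)
    (L : (X -> R) -> X -> R) u (w : nat -> X -> R) :
  (forall n, Lp_contraction (T n)) -> Lp_contraction L ->
  u \in Lfun mu p%:E -> (forall j, w j \in Lfun mu p%:E) ->
  N (fun x => u x - w j x)%R @[j --> \oo] --> 0%E ->
  (forall j, N (fun x => T n (w j) x - L (w j) x)%R @[n --> \oo] --> 0%E) ->
  N (fun x => T n u x - L u x)%R @[n --> \oo] --> 0%E.
Proof.
move=> TC LC uL wL uw Tw; apply: Lnorm_cvg0 => e e0.
have e30 : 0 < e / 3 by rewrite divr_gt0.
have [j _ /(_ j (leqnn j)) wj] := Lnorm_cvg0_le e30 uw.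
have TwLe := @Lnorm_cvg0_le _ _ eventually_filter _ _ e30 (Tw j); near=> n.
have Tn : (N (fun x => T n (w j) x - L (w j) x)%R <= (e / 3)%:E)%E by near: n.
have [Tu Tuw _] := TC n u (w j) uL (wL j); have [Lu Luw _] := LC u (w j) uL (wL j).
have uwL := LfunB uL (wL j).
have [Twj _ _] := TC n (w j) u (wL j) uL; have [Lwj _ _] := LC (w j) u (wL j) uL.
have [Td _ Td_le] := TC n _ u uwL uL; have [Ld _ Ld_le] := LC _ u uwL uL.
have -> : (fun x => T n u x - L u x) =
    (fun x => (T n (fun x => u x - w j x) x - L (fun x => u x - w j x) x) +
              (T n (w j) x - L (w j) x)).
  by apply/funext => x; rewrite Tuw Luw; ring.
have [mTd mLd] := (Lfun_measurable Td, Lfun_measurable Ld).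
apply: le_trans (LnormD_le _ _) _.
- exact: measurable_funB.
- by apply: measurable_funB; exact: Lfun_measurable.
have -> : e = e / 3 + e / 3 + e / 3 by field.
rewrite EFinD; apply: leeD => //.
apply: le_trans (LnormB_le mTd mLd) _.
rewrite EFinD; apply: leeD.
  exact: le_trans Td_le wj.
exact: le_trans Ld_le wj.
Unshelve. all: by end_near. Qed.

End Lp_toolkit.


(** * Density of dyadic functions in L1 *)

Section dyadic_density.
Set Implicit Arguments.
Unset Strict Implicit.
Context {R : realType} {d} {X : measurableType d} {rho : X -> X -> R}.
Variables (D : dyadic_system rho) (mu : {measure set X -> \bar R}).
Hypothesis rho_qmetric : quasi_metric rho.
Hypothesis X_borel : borel_space rho.
Hypothesis cube_fin : forall k (a : dy_idx D k), (mu (dy_cube a) < +oo)%E.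
Implicit Types (k l : int) (A B : set X) (f g : X -> R).

(** A cube of generation [n] lies in the ball of radius [C1 * delta ^ n] about its centre, so any
    two of its points are at distance less than [2 * A0 * C1 * delta ^ n], which tends to 0. *)
Lemma small_cubes x (r : R) : 0 < r ->
  exists n : nat, dy_cube (cube_at D n%:Z x) `<=` qball rho x r.
Proof.
case: rho_qmetric => rho0 rhoC _ [A0 A01 rhoA] r0.
have /andP[d0 d1] := dy_delta_in D.
have /andP[c10 c1C1] := dy_c1_C1 D.
have C0 : 0 < A0 * (2 * dy_C1 D).
  by rewrite mulr_gt0 ?mulr_gt0 ?(lt_le_trans ltr01 A01)// (lt_le_trans c10).
have /cvgrPdist_lt /(_ (r / (A0 * (2 * dy_C1 D)))) : (dy_delta D ^+ n @[n --> \oo] --> (0 : R)).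
  by apply: cvg_expr; rewrite gtr0_norm.
rewrite divr_gt0// => /(_ isT)[n _ /(_ n (leqnn n))] /=.
rewrite sub0r normrN gtr0_norm ?exprn_gt0// ltr_pdivlMr// => nr.
exists n => y ny; rewrite /qball/=.
have xn := dy_sub_ball (cube_atP D n%:Z x).
have yn := dy_sub_ball ny.
rewrite /qball/= in xn yn.
apply: le_lt_trans (rhoA _ _ (dy_center (cube_at D n%:Z x))) _.
apply: lt_trans nr; rewrite -exprnP in xn yn.
have -> : dy_delta D ^+ n * (A0 * (2 * dy_C1 D)) =
  A0 * (dy_C1 D * dy_delta D ^+ n + dy_C1 D * dy_delta D ^+ n) by ring.
by rewrite rhoC ltr_pM2l ?(lt_le_trans ltr01)// ltrD.
Qed.

(** [V n] is the union of the cubes of generation [n] contained in [U]; small cubes around a point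
    of [U] are among them. *)
Lemma qopen_bigcup_dyadic (U : set X) : qopen rho U ->
  exists2 V : nat -> set X, forall n, dyadic_set D n%:Z (V n) &
    U = \bigcup_n V n.
Proof.
move=> oU; exists (fun n => [set x | dy_cube (cube_at D n%:Z x) `<=` U]).
  by move=> n x y xy /=; rewrite xy.
apply/seteqP; split => [x Ux|x [n _]]; last by apply; exact: cube_atP.
have [r r0 rU] := oU x Ux.
by have [n nr] := small_cubes x r0; exists n => //; exact: subset_trans rU.
Qed.

(** * Approximation of measurable sets by unions of cubes *)

Section approximation_of_sets.
Variable Q : set X.
Hypotheses (mQ : measurable Q) (Qfin : (mu Q < +oo)%E).

(** The symmetric difference is measured inside a set [Q] of finite measure, so that continuity from
    above is available. Measurability is included so that induction over the generated sigma-algebra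
    carries it along. *)
Definition dyadic_approx A : Prop := measurable A /\
  forall e : R, 0 < e -> exists k, exists2 B, dyadic_set D k B &
    (mu (Q `&` ((A `\` B) `|` (B `\` A))) < e%:E)%E.

Lemma dyadic_approx_dyadic k A : dyadic_set D k A -> dyadic_approx A.
Proof.
move=> kA; split; first exact: measurable_dyadic_set kA.
by move=> e e0; exists k, A => //; rewrite setDv setU0 setI0 measure0 lte_fin.
Qed.

Lemma dyadic_approxC A : dyadic_approx A -> dyadic_approx (~` A).
Proof.
move=> [mA Ae]; split; first exact: measurableC.
move=> e /Ae[k [B kB BA]]; exists k, (~` B); first exact: dyadic_setC.
by move: BA; rewrite !setDE !setCK setUC (setIC B) (setIC A).
Qed.

Lemma dyadic_approxU A1 A2 :
  dyadic_approx A1 -> dyadic_approx A2 -> dyadic_approx (A1 `|` A2).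
Proof.
move=> [mA1 A1e] [mA2 A2e]; split; first exact: measurableU.
move=> e e0; have e20 : 0 < e / 2 by rewrite divr_gt0.
have [k1 [B1 kB1 B1e]] := A1e _ e20; have [k2 [B2 kB2 B2e]] := A2e _ e20.
have mB1 := measurable_dyadic_set kB1; have mB2 := measurable_dyadic_set kB2.
(* A union of cubes of one generation is also one of any finer generation, so the larger index
   serves both sets. *)
exists (Order.max k1 k2), (B1 `|` B2).
  by apply: dyadic_setU; [apply: dyadic_set_finer kB1|apply: dyadic_set_finer kB2];
     rewrite le_max lexx ?orbT.
pose S A B := Q `&` ((A `\` B) `|` (B `\` A)).
have mS A B : measurable A -> measurable B -> measurable (S A B).
  by move=> mA mB; apply: measurableI => //; apply: measurableU; exact: measurableD.
apply: (@le_lt_trans _ _ (mu (S A1 B1 `|` S A2 B2))).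
  apply: le_measure; rewrite ?inE.
  - by apply: mS; exact: measurableU.
  - by apply: measurableU; exact: mS.
  - move=> x [Qx [[[Ax|Ax] /not_orP[nB1 nB2]]|[[Bx|Bx] /not_orP[nA1 nA2]]]].
    + by left; split=> //; left.
    + by right; split=> //; left.
    + by left; split=> //; right.
    + by right; split=> //; right.
apply: le_lt_trans (measureU2 _ (mS _ _ mA1 mB1) (mS _ _ mA2 mB2)) _.
by rewrite [e]splitr EFinD lteD.
Qed.

(** Inside [Q] the union exceeds its finite part [G n] by [H n]. These sets decrease to the empty
    set, so [mu (H n)] tends to 0; it then suffices to approximate a finite union. *)
Lemma dyadic_approx_bigcup (F : nat -> set X) :
  (forall n, dyadic_approx (F n)) -> dyadic_approx (\bigcup_n F n).
Proof.
move=> FA.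
have mF : measurable (\bigcup_n F n).
  by apply: bigcup_measurable => n _; exact: (FA n).1.
split=> // e e0; have e20 : 0 < e / 2 by rewrite divr_gt0.
pose G n := \big[setU/set0]_(i < n) F i.
have GA n : dyadic_approx (G n).
  rewrite /G; elim: n => [|n IH].
    by rewrite big_ord0; apply: (@dyadic_approx_dyadic 0) => ? ? ?.
  by rewrite big_ord_recr; exact: dyadic_approxU.
pose H n := Q `&` (\bigcup_n F n `\` G n).
have mH n : measurable (H n).
  by apply: measurableI => //; apply: measurableD => //; exact: (GA n).1.
have H0 : \bigcap_n H n = set0.
  rewrite -subset0 => x Hx; have [Qx [[n _ Fx] _]] := Hx 0%N I.
  have [_ [_]] := Hx n.+1 I; apply.
  by rewrite /G big_ord_recr; right.
have : mu \o H @ \oo --> mu (\bigcap_n H n).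
  apply: nonincreasing_cvg_mu => //.
  - apply: le_lt_trans Qfin; apply: le_measure; rewrite ?inE//.
    exact: subIsetl.
  - by rewrite H0.
  - move=> m n mn; apply/subsetPset; apply: setIS; apply: setDS.
    rewrite /G -(subnKC mn) big_split_ord/= => x ?; left.
    by rewrite (eq_bigr (fun i : 'I_m => F i)).
rewrite H0 measure0 => /fine_cvgP[Hfin /cvgrPdist_lt /(_ _ e20) Hlt].
have [n _ /(_ n (leqnn n)) [Hn1 Hn2]] := filterI Hfin Hlt.
have [k [B kB Be]] := (GA n).2 _ e20.
exists k, B => //; have mB := measurable_dyadic_set kB.
have mGB : measurable (Q `&` ((G n `\` B) `|` (B `\` G n))).
  apply: measurableI => //.
  by apply: measurableU; apply: measurableD => //; exact: (GA n).1.
apply: (@le_lt_trans _ _ (mu (H n `|` Q `&` ((G n `\` B) `|` (B `\` G n))))).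
  apply: le_measure; rewrite ?inE.
  - by apply: measurableI => //; apply: measurableU; exact: measurableD.
  - exact: measurableU.
  - move=> x [Qx [[Fx nB]|[Bx nF]]].
      have [Gx|nG] := pselect (G n x); last by left.
      by right; split => //; left.
    right; split => //; right; split => // Gx; apply: nF.
    move: Gx; rewrite /G -bigcup_mkord => -[i _ Fx]; by exists i.
have Hne : (mu (H n) < (e / 2)%:E)%E.
  rewrite (_ : mu (H n) = (fine ((mu \o H) n))%:E); last by rewrite fineK.
  by rewrite lte_fin; move: Hn2; rewrite sub0r normrN ger0_norm// fine_ge0.
apply: le_lt_trans (measureU2 _ (mH n) mGB) _.
by rewrite [e]splitr EFinD; exact: lteD.
Qed.

Lemma measurable_dyadic_approx A : measurable A -> dyadic_approx A.
Proof.
case: X_borel => -> _; apply: (@smallest_sub _ _ _ dyadic_approx).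
  split.
  - by apply: (@dyadic_approx_dyadic 0) => ? ? ?.
  - by move=> B BA; rewrite setTD; exact: dyadic_approxC.
  - by move=> F FA; exact: dyadic_approx_bigcup.
move=> U /qopen_bigcup_dyadic[V kV ->].
by apply: dyadic_approx_bigcup => n; exact: dyadic_approx_dyadic (kV n).
Qed.

End approximation_of_sets.

(** * The L^1 closure of the functions constant on cubes of one generation *)

Local Notation N1 u := ('N[mu]_1%:E[EFin \o u])%E.

Definition dyadic_L1 f : Prop := f \in Lfun mu 1%:E /\
  forall e : R, 0 < e -> exists k, exists2 h, dyadic_fun D k h &
    h \in Lfun mu 1%:E /\ (N1 (fun x => f x - h x)%R < e%:E)%E.

Lemma dyadic_L1_cst0 : dyadic_L1 (cst 0).
Proof.
have L0 : cst 0 \in Lfun mu 1%:E.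
  by apply/LfunE => //; split => //; rewrite Lnorm0.
split=> // e e0; exists 0, (cst 0) => //; split=> //.
rewrite (_ : (fun _ => _) = cst 0); first by rewrite Lnorm0 ?lte_fin.
by apply/funext => x; rewrite subr0.
Qed.

Lemma dyadic_L1D f g : dyadic_L1 f -> dyadic_L1 g ->
  dyadic_L1 (fun x => f x + g x).
Proof.
move=> [f1 fe] [g1 ge]; split; first exact: LfunD.
move=> e e0; have e20 : 0 < e / 2 by rewrite divr_gt0.
have [k [h kh [h1 he]]] := fe _ e20; have [l [i li [i1 ie]]] := ge _ e20.
exists (Order.max k l), (fun x => h x + i x).
  move=> x y xy; congr (_ + _).
    by apply: kh; apply: cube_at_coarser xy; rewrite le_max lexx.
  by apply: li; apply: cube_at_coarser xy; rewrite le_max lexx orbT.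
split; first exact: LfunD.
have -> : (fun x => f x + g x - (h x + i x)) =
  (fun x => (f x - h x) + (g x - i x)) by apply/funext => x; ring.
have mf := Lfun_measurable f1.
have mg := Lfun_measurable g1.
have mh := Lfun_measurable h1.
have mi := Lfun_measurable i1.
apply: le_lt_trans (LnormD_le _ (lexx 1) _ _) _; [exact: measurable_funB..|].
by rewrite [e]splitr EFinD lteD.
Qed.

Lemma dyadic_L1Z c f : dyadic_L1 f -> dyadic_L1 (fun x => c * f x).
Proof.
move=> [f1 fe]; split; first exact: LfunZl.
(* The added 1 keeps the tolerance [e / (|c| + 1)] positive when [c] is 0. *)
move=> e e0; have c0 : 0 < `|c| + 1 by rewrite ltr_wpDl.
have [k [h kh [h1 he]]] := fe _ (divr_gt0 e0 c0).
exists k, (fun x => c * h x); first by move=> x y xy; rewrite (kh x y).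
split; first exact: LfunZl.
have -> : (fun x => c * f x - c * h x) = (fun x => c * (f x - h x)).
  by apply/funext => x; ring.
have mf := Lfun_measurable f1.
have mh := Lfun_measurable h1.
rewrite LnormZl//; last exact: measurable_funB.
have Nf : (N1 (fun x => f x - h x)%R \is a fin_num)%E.
  by rewrite ge0_fin_numE ?Lnorm_ge0// (lt_le_trans he)// leey.
rewrite -(fineK Nf) in he *; rewrite lte_fin ltr_pdivlMr// in he.
rewrite -EFinM lte_fin; apply: le_lt_trans he.
by rewrite mulrC ler_wpM2l ?fine_ge0 ?Lnorm_ge0// lerDl.
Qed.

Lemma dyadic_L1_lim f : f \in Lfun mu 1%:E ->
  (forall e : R, 0 < e -> exists2 g, dyadic_L1 g &
    (N1 (fun x => f x - g x)%R < e%:E)%E) -> dyadic_L1 f.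
Proof.
move=> f1 fe; split=> // e e0; have e20 : 0 < e / 2 by rewrite divr_gt0.
have [g [g1 ge] fg] := fe _ e20; have [k [h kh [h1 gh]]] := ge _ e20.
exists k, h => //; split => //.
have -> : (fun x => f x - h x) = (fun x => (f x - g x) + (g x - h x)).
  by apply/funext => x; ring.
have mf := Lfun_measurable f1.
have mg := Lfun_measurable g1.
have mh := Lfun_measurable h1.
apply: le_lt_trans (LnormD_le _ (lexx 1) _ _) _; [exact: measurable_funB..|].
by rewrite [e]splitr EFinD lteD.
Qed.

Lemma Lfun1_indic A : measurable A -> (mu A < +oo)%E ->
  (\1_A : X -> R) \in Lfun mu 1%:E.
Proof.
move=> mA Afin; apply/LfunE => //; split; first exact: measurable_indic.
rewrite Lnorm1; under eq_integral do rewrite /= ger0_norm//.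
by rewrite integral_indic// setIT.
Qed.

(** A union [B] of cubes approximating [A] inside the cube is cut down to the cube. The absolute
    difference of the two indicators is the indicator of the symmetric difference inside the cube,
    so the L^1 distance is the measure already controlled. *)
Lemma dyadic_L1_indic k (a : dy_idx D k) A : measurable A ->
  dyadic_L1 (\1_(A `&` dy_cube a)).
Proof.
move=> mA; have ma := @dy_measurable _ _ _ _ D k a.
have afin := cube_fin a.
have fin B : measurable B -> (mu (B `&` dy_cube a) < +oo)%E.
  move=> mB; apply: le_lt_trans afin; apply: le_measure; rewrite ?inE//.
  exact: measurableI.
split; first by apply: Lfun1_indic; [exact: measurableI|exact: fin].
move=> e /(measurable_dyadic_approx ma afin mA).2[l [B lB AB]].
have mB := measurable_dyadic_set lB.
exists (Order.max k l), (\1_(B `&` dy_cube a)).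
  apply: dyadic_fun_indic; apply: dyadic_setI.
    by apply: dyadic_set_finer lB; rewrite le_max lexx orbT.
  by apply: dyadic_set_cube; rewrite le_max lexx.
split; first by apply: Lfun1_indic; [exact: measurableI|exact: fin].
apply: le_lt_trans AB; rewrite Lnorm1.
set S := dy_cube a `&` _.
have mS : measurable S.
  by apply: measurableI => //; apply: measurableU; exact: measurableD.
have <- : (\int[mu]_x (\1_S x)%:E = mu S)%E by rewrite integral_indic// setIT.
rewrite le_eqVlt; apply/orP; left; apply/eqP; apply: eq_integral => x _ /=.
rewrite /S !indicE !in_setI !in_setU !in_setD.
by case: (x \in A); case: (x \in B); case: (x \in dy_cube a) => /=;
  rewrite ?subr0 ?sub0r ?subrr ?normrN ?normr1 ?normr0.
Qed.

Import HBSimple.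

(** Simple functions approximate [f] in L^1 on the cube; restricted to the cube, each is a finite
    linear combination of indicators already treated. *)
Lemma dyadic_L1_integrable k (a : dy_idx D k) f :
  mu.-integrable (dy_cube a) (EFin \o f) ->
  dyadic_L1 (fun x => f x * \1_(dy_cube a) x).
Proof.
move=> fi; have ma := @dy_measurable _ _ _ _ D k a.
have mulE g : (fun x => g x * \1_(dy_cube a) x) = g \_ (dy_cube a).
  by apply/funext => x; rewrite /patch indicE; case: ifP; rewrite ?mulr1 ?mulr0.
have L1 g : mu.-integrable (dy_cube a) (EFin \o g) ->
    (fun x => g x * \1_(dy_cube a) x) \in Lfun mu 1%:E.
  move=> gi; rewrite mulE; apply/Lfun1_integrable.
  rewrite (_ : EFin \o g \_ (dy_cube a) = (EFin \o g) \_ (dy_cube a)).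
    by apply/(integrable_mkcond _ ma).1.
  by apply/funext => x; rewrite /patch/=; case: ifP.
have [g_ [gi _ gf]] := approximation_sfun_integrable ma fi.
apply: dyadic_L1_lim; first exact: L1.
move=> e e0; move/fine_cvgP : gf => [gfin /cvgrPdist_lt /(_ _ e0) gle].
have [n _ /(_ n (leqnn n)) [gnfin gne]] := filterI gfin gle.
exists (fun x => g_ n x * \1_(dy_cube a) x); last first.
  rewrite Lnorm1.
  have -> : (\int[mu]_x `|(EFin \o (fun x0 => f x0 * \1_(dy_cube a) x0 -
      g_ n x0 * \1_(dy_cube a) x0)%R) x|
     = \int[mu]_(x in dy_cube a) `|(f x)%:E - (g_ n x)%:E|)%E.
    rewrite [RHS]integral_mkcond; apply: eq_integral => x _ /=.
    rewrite /patch indicE; case: ifP => _; first by rewrite !mulr1.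
    by rewrite !mulr0 subr0 normr0.
  rewrite -(fineK gnfin) lte_fin; move: gne.
  by rewrite sub0r normrN; apply: le_lt_trans; exact: ler_norm.
have -> : (fun x => g_ n x * \1_(dy_cube a) x) = (fun x =>
    \sum_(y <- fset_set (range (g_ n)))
       y * \1_((g_ n @^-1` [set y]) `&` dy_cube a) x).
  apply/funext => x; rewrite (fimfunE (g_ n)) fsbig_finite//=.
  rewrite mulr_suml; apply: eq_bigr => y _.
  by rewrite -mulrA; congr (_ * _); rewrite !indicE in_setI -natrM mulnb.
elim: (enum_fset _) => [|y s IH].
  rewrite (_ : (fun _ => _) = cst 0); first exact: dyadic_L1_cst0.
  by apply/funext => x; rewrite big_nil.
rewrite (_ : (fun _ => _) = (fun x => y * \1_((g_ n @^-1` [set y]) `&` dy_cube a) x +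
  \sum_(y <- s) y * \1_((g_ n @^-1` [set y]) `&` dy_cube a) x)); last first.
  by apply/funext => x; rewrite big_cons.
apply: dyadic_L1D => //; apply: dyadic_L1Z; apply: dyadic_L1_indic.
exact: measurable_funPTI.
Qed.

End dyadic_density.

(** * Almost everywhere convergence for fine generations *)

Section martingale_convergence.
Set Implicit Arguments.
Unset Strict Implicit.
Context {R : realType} {d} {X : measurableType d} {rho : X -> X -> R}.
Variables (D : dyadic_system rho) (mu : {measure set X -> \bar R}).
Hypothesis rho_qmetric : quasi_metric rho.
Hypothesis X_borel : borel_space rho.
Hypothesis cube_fin : forall k (a : dy_idx D k), (mu (dy_cube a) < +oo)%E.
Implicit Types (k l m : int) (A B : set X) (f g : X -> R).

Lemma ae_forall_countable (I : countType) (P : I -> X -> Prop) :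
  (forall i, {ae mu, forall x, P i x}) -> {ae mu, forall x i, P i x}.
Proof.
move=> Pi; rewrite /prop_near1/= /almost_everywhere.
pose F n := if pickle_inv n is Some i then ~` [set x | P i x] else set0.
have : mu.-negligible (\bigcup_n F n).
  apply: negligible_bigcup => n; rewrite /F; case: pickle_inv => [i|].
    exact: Pi.
  exact: negligible_set0.
apply: negligibleS => x /= /existsNP[i nPi].
by exists (choice.pickle i) => //; rewrite /F pickleK_inv.
Qed.

(** There are countably many cubes, so the null ones together form a null set. Identities between
    means are used off this set. *)
Lemma ae_nonnull_cubes :
  {ae mu, forall x k, mu (dy_cube (cube_at D k x)) != 0%E}.
Proof.
apply: ae_forall_countable => k.
have : {ae mu, forall x (a : dy_idx D k), dy_cube a x -> mu (dy_cube a) != 0%E}.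
  apply: ae_forall_countable => a.
  have [a0|a0] := eqVneq (mu (dy_cube a)) 0%E; last exact: aeW.
  exists (dy_cube a); split => //; first exact: dy_measurable.
  by move=> x /= /not_implyP[].
by apply: filterS => x ax; apply: ax; exact: cube_atP.
Qed.

Lemma condexp_dyadic k l h x : k <= l -> dyadic_fun D k h ->
  mu (dy_cube (cube_at D l x)) != 0%E -> condexp D mu l h x = h x.
Proof.
move=> kl kh x0; apply: mean_cst => //; first exact: dy_measurable.
by move=> y /cube_at_eq xy; apply: kh; apply: cube_at_coarser kl _.
Qed.

Lemma chebyshev_integral g (lam : R) : (forall x, 0 <= g x) ->
  measurable_fun setT g -> 0 < lam ->
  measurable [set x | lam < g x] /\
  (lam%:E * mu [set x | (lam < g x)%R] <= \int[mu]_x (g x)%:E)%E.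
Proof.
move=> g0 mg lam0.
have mW : measurable [set x | lam < g x].
  have := mg measurableT _ (measurable_itv `]lam, +oo[).
  congr measurable; apply/seteqP; split=> x /=; rewrite in_itv/= andbT //.
  by case.
split=> //; rewrite -integral_cst//.
apply: (@le_trans _ _ (\int[mu]_(x in [set x | (lam < g x)%R]) (g x)%:E)%E).
  apply: ge0_le_integral => //.
  - by move=> x _; rewrite lee_fin ltW.
  - by apply/measurable_EFinP; exact: measurable_funTS.
  - by move=> x /ltW; rewrite lee_fin.
apply: ge0_subset_integral => //; first exact/measurable_EFinP.
by move=> x _; rewrite lee_fin.
Qed.

(** For a dyadic [h] close to [f] and late generations, [E f - f = E (f - h) - (f - h)]. Outside a
    small set the first term is at most [lam / 2] by the maximal inequality for [|f - h|], the
    second by Chebyshev's inequality. An L^1 distance below [lam / 2 * (e / 2)] gives each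
    exceptional set measure at most [e / 2]. *)
Lemma condexp_almost_uniform f m (e lam : R) :
  dyadic_L1 D mu f -> 0 < e -> 0 < lam ->
  exists W, [/\ measurable W, (mu W <= e%:E)%E & exists N : nat,
    forall x, ~ W x -> (forall k, mu (dy_cube (cube_at D k x)) != 0%E) ->
    forall n, (N <= n)%N -> `|condexp D mu (m + n%:Z) f x - f x| <= lam].
Proof.
move=> [f1 fe] e0 lam0; have lam20 : 0 < lam / 2 by rewrite divr_gt0.
have e20 : 0 < e / 2 by rewrite divr_gt0.
have [k [h kh [h1 fh]]] := fe _ (mulr_gt0 lam20 e20).
pose g x := `|f x - h x|; have g0 x : 0 <= g x by exact: normr_ge0.
have ghL : (fun x => f x - h x) \in Lfun mu 1%:E by exact: LfunB.
have fi : mu.-integrable setT (EFin \o f) by exact/Lfun1_integrable.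
have hi : mu.-integrable setT (EFin \o h) by exact/Lfun1_integrable.
have fhi : mu.-integrable setT (EFin \o (fun x => f x - h x)).
  exact/Lfun1_integrable.
have gi : mu.-integrable setT (EFin \o g).
  exact: integrable_norm fhi.
have mg : measurable_fun setT g.
  by have /integrableP[/measurable_EFinP] := gi.
rewrite Lnorm1 in fh.
(* This [N] ensures [k <= m + N]: from generation [m + N] on, [h] is constant on the cubes and
   equals its means over the non-null ones. *)
pose N := `|k - m|%N.
have kN : k <= m + N%:Z by rewrite -lerBlDl; exact: lez_abs.
have [mW1 W1] := chebyshev_integral g0 mg lam20.
have [mW2 W2] := weak_type cube_fin (m + N%:Z) g0 gi lam20.
set U1 := [set x | _] in mW1 W1; set U2 := [set x | _] in mW2 W2.
exists (U1 `|` U2); split; first exact: measurableU.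
  apply: le_trans (measureU2 _ mW1 mW2) _.
  have half U : (((lam / 2)%:E * mu U) <= \int[mu]_x (g x)%:E -> mu U <= (e / 2)%:E)%E.
    move=> HU; rewrite -(lee_pmul2l _ (_ : 0 < (lam / 2)%:E)%E)//.
    by apply: le_trans HU _; rewrite -EFinM; exact: ltW.
  by rewrite [e]splitr EFinD leeD// half.
exists N => x /not_orP[nU1 nU2] x0 n Nn.
have nE : m + n%:Z = (m + N%:Z) + (n - N)%N%:Z.
  by rewrite -addrA -PoszD subnKC.
have kn : k <= m + n%:Z by apply: le_trans kN _; rewrite lerD2l lez_nat.
have lx : dyadic_set D (m + n%:Z) (dy_cube (cube_at D (m + n%:Z) x)).
  exact: dyadic_set_cube.
have ma := @dy_measurable _ _ _ _ D _ (cube_at D (m + n%:Z) x).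
have int u : mu.-integrable setT (EFin \o u) ->
    mu.-integrable (dy_cube (cube_at D (m + n%:Z) x)) (EFin \o u).
  by move=> ui; apply: integrableS ui.
have Eh : condexp D mu (m + n%:Z) h x = h x by exact: condexp_dyadic kn kh _.
have -> : condexp D mu (m + n%:Z) f x - f x =
  condexp D mu (m + n%:Z) (f \- h) x - (f x - h x).
  have -> : condexp D mu (m + n%:Z) (f \- h) x =
      condexp D mu (m + n%:Z) f x - condexp D mu (m + n%:Z) h x.
    by rewrite /condexp meanB//; exact: int.
  by rewrite Eh; ring.
apply: le_trans (ler_normB _ _) _.
rewrite [lam]splitr; apply: lerD.
  apply: le_trans (ler_norm_mean ma (int _ fhi)) _.
  rewrite leNgt; apply/negP => H; apply: nU2; exists (n - N)%N.
  by rewrite -nE.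
by rewrite leNgt; apply/negP => H; exact: nU1.
Qed.

(** [W (i, j)] has measure at most [1 / (i + 1)], and off it, where all cubes are non-null, the
    error is eventually at most [1 / (j + 1)]. For each [j] the intersection over [i] is null, so
    almost every point escapes some [W (i, j)] for every [j]. *)
Lemma condexp_ae_L1 f m : dyadic_L1 D mu f ->
  {ae mu, forall x, condexp D mu (m + n%:Z) f x @[n --> \oo] --> f x}.
Proof.
move=> fL.
have inv0 (n : nat) : 0 < (n.+1%:R : R)^-1 by rewrite invr_gt0.
have /choice[W HW] (ij : nat * nat) := condexp_almost_uniform m fL (inv0 ij.1) (inv0 ij.2).
have H : {ae mu, forall x (j : nat), exists i, ~ W (i, j) x}.
  apply: ae_forall_countable => j.
  exists (\bigcap_i W (i, j)); split.
  - by apply: bigcapT_measurable => i; have [] := HW (i, j).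
  - apply/eqP; rewrite -measure_le0; apply/lee_addgt0Pr => e e0; rewrite add0e.
    have [i ie] : exists i : nat, (i.+1%:R : R)^-1 <= e.
      exists (Num.truncn e^-1); rewrite invf_ple ?posrE//.
      by apply: ltW; apply: truncnS_gt.
    have [mWi Wi _] := HW (i, j).
    apply: le_trans (le_trans Wi _); last by rewrite lee_fin.
    apply: le_measure; rewrite ?inE//; last exact: bigcap_inf.
    by apply: bigcapT_measurable => i'; have [] := HW (i', j).
  - by move=> x /= nx i _; apply: contrapT => nW; apply: nx; exists i.
near=> x.
have xW : forall j, exists i, ~ W (i, j) x by near: x.
have x0 : forall k, mu (dy_cube (cube_at D k x)) != 0%E.
  by near: x; exact: ae_nonnull_cubes.
apply/cvgrPdist_le => e e0.
have ie : (Num.truncn e^-1).+1%:R^-1 <= e.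
  by rewrite invf_ple ?posrE//; apply: ltW; apply: truncnS_gt.
have [i iW] := xW (Num.truncn e^-1).
have [_ _ [N HN]] := HW (i, Num.truncn e^-1).
near=> n; rewrite distrC; apply: le_trans (HN x iW x0 n _) ie.
by near: n; exists N.
Unshelve. all: by end_near. Qed.

(** The bound is [|f| <= 1 + |f| ^ p], whose right side is integrable over a set of finite
    measure. *)
Lemma Lfun_loc_int (p : R) f A : 1 <= p -> f \in Lfun mu p%:E ->
  measurable A -> (mu A < +oo)%E -> mu.-integrable A (EFin \o f).
Proof.
move=> p1 fp mA Afin; have mf := Lfun_measurable fp.
have fi : mu.-integrable A (fun x => (`|f x| `^ p)%:E).
  by apply: integrableS (Lfun_integrable p1 fp).
have ci : mu.-integrable A (EFin \o (cst 1 : X -> R)).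
  apply: measurable_bounded_integrable => //.
  by exists 1; split => // M M1 x _ /=; rewrite normr1 ltW.
have := integrableD mA ci fi.
apply: le_integrable => //; first exact/measurable_EFinP/measurable_funTS.
move=> x _ /=; rewrite lee_fin [leRHS]ger0_norm ?addr_ge0 ?powR_ge0//.
have [fx1|fx1] := leP `|f x| 1; first by rewrite ler_wpDr ?powR_ge0.
rewrite -{1}(powRr1 (normr_ge0 (f x))) ler_wpDl//.
by apply: ler_powR p1; rewrite ltW.
Qed.

(** Localisation: at points of a cube of generation [m], means of generation [m] or finer do not
    change when [f] is multiplied by the indicator of that cube, and the product is integrable.
    Countably many cubes cover [X]. *)
Lemma condexp_ae (p : R) f m : 1 <= p -> f \in Lfun mu p%:E ->
  {ae mu, forall x, condexp D mu (m + n%:Z) f x @[n --> \oo] --> f x}.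
Proof.
move=> p1 fp.
have : {ae mu, forall x (a : dy_idx D m), dy_cube a x ->
    condexp D mu (m + n%:Z) f x @[n --> \oo] --> f x}.
  apply: ae_forall_countable => a.
  have ma := @dy_measurable _ _ _ _ D _ a.
  have fi := Lfun_loc_int p1 fp ma (cube_fin a).
  have := condexp_ae_L1 m (dyadic_L1_integrable rho_qmetric X_borel cube_fin fi).
  apply: filterS => x + ax.
  have -> : f x * \1_(dy_cube a) x = f x by rewrite indicE mem_set// mulr1.
  set u := (X in X @ _ --> _ -> _); set v := (X in _ -> X @ _ --> _).
  suff -> : u = v by [].
  apply/funext => n; rewrite /u /v.
  rewrite /condexp /mean; congr (_ * _); apply: eq_Rintegral => y.
  rewrite inE => xy; rewrite indicE mem_set ?mulr1//.
  by rewrite -(cube_at_eq ax); apply: cube_at_sub xy; rewrite lerDl.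
by apply: filterS => x /(_ (cube_at D m x)); apply; exact: cube_atP.
Qed.

End martingale_convergence.

(** * Jensen contraction and Lp convergence *)

Section Lp_convergence.
Set Implicit Arguments.
Unset Strict Implicit.
Context {R : realType} {d} {X : measurableType d} {rho : X -> X -> R}.
Variables (D : dyadic_system rho) (mu : {measure set X -> \bar R}).
Hypothesis rho_qmetric : quasi_metric rho.
Hypothesis X_borel : borel_space rho.
Hypothesis cube_fin : forall k (a : dy_idx D k), (mu (dy_cube a) < +oo)%E.
Variable p : R.
Hypothesis p_gt1 : 1 < p.
Implicit Types (k l m : int) (A B : set X) (f g : X -> R).
Local Notation N u := ('N[mu]_p%:E[EFin \o u])%E.

Let p0 : 0 < p. Proof. exact: lt_trans p_gt1. Qed.
Let p1 : 1 <= p. Proof. exact: ltW. Qed.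

Lemma jensen_mean A f : measurable A -> (mu A < +oo)%E -> f \in Lfun mu p%:E ->
  ((`|mean mu A f| `^ p)%:E * mu A <= \int[mu]_(x in A) (`|f x| `^ p)%:E)%E.
Proof.
move=> mA Afin fp.
have fi := Lfun_loc_int p1 fp mA Afin.
have fni : mu.-integrable A (EFin \o (fun x => `|f x|)) by exact: integrable_norm.
have fpi : mu.-integrable A (EFin \o (fun x => `|f x| `^ p)).
  by apply: integrableS (Lfun_integrable p1 fp).
set t := mean mu A (fun x => `|f x|).
have t0 : 0 <= t by exact: mean_ge0.
pose q := p / (p - 1).
have q0 : 0 < q by rewrite divr_gt0// subr_gt0.
have pq : p^-1 + q^-1 = 1.
  by rewrite /q invf_div; field; rewrite gt_eqF.
have ci (c : R) : mu.-integrable A (EFin \o (fun _ : X => c)).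
  apply: measurable_bounded_integrable => //.
  exists `|c|; split => // M cM x _ /=; exact: ltW.
have tq : (t `^ (p - 1)) `^ q = t `^ p.
  rewrite -powRrM /q; congr (_ `^ _); field.
  by rewrite subr_eq0 gt_eqF.
(* Young's inequality replaces the supporting line of [t `^ p] in Jensen. *)
have young x : t `^ (p - 1) * `|f x| <= `|f x| `^ p / p + t `^ p / q.
  rewrite mulrC -tq; apply: conjugate_powR => //; exact: powR_ge0.
have afin : mu A \is a fin_num by rewrite ge0_fin_numE.
set M := fine (mu A).
have intt : \int[mu]_(x in A) `|f x| = t * M.
  rewrite /Rintegral -(mule_mean mA Afin fni) fineM//.
set I := \int[mu]_(x in A) (`|f x| `^ p).
have : \int[mu]_(x in A) (t `^ (p - 1) * `|f x|) <=
    \int[mu]_(x in A) (`|f x| `^ p * p^-1 + t `^ p / q).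
  apply: le_Rintegral => //.
  - exact: (integrableZl mA (t `^ (p - 1)) fni).
  - exact: (integrableD mA (integrableZr mA p^-1 fpi) (ci (t `^ p / q))).
rewrite RintegralZl// RintegralD//; last exact: (integrableZr mA p^-1 fpi).
rewrite RintegralZr// Rintegral_cst// intt -/I -/M.
rewrite mulrA (mulrC _ t) mulr_powRB1// => ineq.
(* Moving [t ^ p * M / q] to the left leaves the factor [1 - 1 / q = 1 / p] on both sides. *)
have {}ineq : t `^ p * M <= I.
  have : t `^ p * M * p^-1 <= I * p^-1.
    have -> : p^-1 = 1 - q^-1 by rewrite -pq addrK.
    move: ineq; rewrite -pq => ineq; nra.
  by rewrite ler_pM2r// invr_gt0.
have IE : (\int[mu]_(x in A) (`|f x| `^ p)%:E)%E = I%:E.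
  by rewrite /I /Rintegral fineK//; exact: integrable_fin_num.
rewrite IE -(fineK afin) -EFinM lee_fin; apply: le_trans ineq.
rewrite ler_wpM2r ?fine_ge0// ge0_ler_powR ?nnegrE ?(ltW p0)//.
exact: ler_norm_mean.
Qed.

Lemma integral_condexp_powR_le k f : f \in Lfun mu p%:E ->
  (\int[mu]_x (`|condexp D mu k f x| `^ p)%:E <= \int[mu]_x (`|f x| `^ p)%:E)%E.
Proof.
move=> fp; have mf := Lfun_measurable fp.
have cubesE g : measurable_fun setT g -> (\int[mu]_x (`|g x| `^ p)%:E =
    \sum_(n <oo) \int[mu]_(x in cube_seq D k n) (`|g x| `^ p)%:E)%E.
  move=> mg; rewrite -(cube_seq_cover D k); apply: ge0_integral_bigcup.
  - exact: measurable_cube_seq.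
  - by rewrite cube_seq_cover; exact: measurable_normr_powR.
  - by move=> x _; rewrite lee_fin powR_ge0.
  - exact: trivIset_cube_seq.
rewrite (cubesE _ mf) (cubesE _ (@measurable_condexp _ _ _ _ D mu k f)).
apply: lee_nneseries => [n _|n _].
  by rewrite integral_ge0// => x _; rewrite lee_fin powR_ge0.
have [->|[a ->]] := cube_seqP D k n; first by rewrite !integral_set0.
have ma := @dy_measurable _ _ _ _ D _ a.
rewrite (eq_integral (cst (`|mean mu (dy_cube a) f| `^ p)%:E)); last first.
  by move=> x; rewrite inE => ax; rewrite (condexpE _ _ ax).
by rewrite integral_cst//; exact: jensen_mean.
Qed.

Lemma Lp_contraction_condexp k : Lp_contraction mu p (condexp D mu k).
Proof.
move=> f g fp gp.
have le := le_Lnorm_powR p1 (integral_condexp_powR_le k fp).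
split => //.
  apply/LfunE; split; first exact: measurable_condexp.
  by apply: le_lt_trans le _; have /LfunE[] := fp.
apply/funext => x; have ma := @dy_measurable _ _ _ _ D _ (cube_at D k x).
rewrite /condexp; apply: meanB => //; first exact: (Lfun_loc_int p1 fp).
exact: (Lfun_loc_int p1 gp).
Qed.

Lemma Lfun_condexp k f : f \in Lfun mu p%:E -> condexp D mu k f \in Lfun mu p%:E.
Proof. by move=> fp; have [] := Lp_contraction_condexp k fp fp. Qed.

Lemma norm_mean_le A f (c : R) : measurable A -> (mu A < +oo)%E ->
  mu.-integrable A (EFin \o f) -> 0 <= c -> (forall x, A x -> `|f x| <= c) ->
  `|mean mu A f| <= c.
Proof.
move=> mA Afin fi c0 fc; apply: le_trans (ler_norm_mean mA fi) _.
have [A0|A0] := eqVneq (mu A) 0%E.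
  by rewrite /mean A0 invr0 mul0r.
have ci : mu.-integrable A (EFin \o (fun _ : X => c)).
  apply: measurable_bounded_integrable => //.
  by exists `|c|; split => // M cM x _ /=; exact: ltW.
apply: (@le_trans _ _ (mean mu A (fun=> c))).
  by apply: le_mean => //; exact: integrable_norm.
by rewrite (mean_cst (c := c)).
Qed.

Lemma Lfun_bounded_support (c : R) A : measurable A -> (mu A < +oo)%E ->
  (fun x => c * \1_A x) \in Lfun mu p%:E.
Proof.
move=> mA Afin; apply: LfunZl => //; apply/Lfun_powR => //.
split; first exact: measurable_indic.
apply: (eq_integrable _ (fun x => (\1_A x)%:E)) => //.
  by move=> x _ /=; rewrite indicE; case: (_ \in _);
     rewrite ?normr1 ?powR1// normr0 powR0// gt_eqF.
apply/integrableP; split; first exact/measurable_EFinP/measurable_indic.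
by under eq_integral do rewrite gee0_abs ?lee_fin//; rewrite integral_indic// setIT.
Qed.

(** Values larger than [c] in modulus are replaced by 0, not capped at [c]. *)
Definition truncate (A : set X) (c : R) f (x : X) : R :=
  f x * \1_(A `&` [set y | `|f y| <= c]) x.

Lemma truncateE A c f x :
  truncate A c f x = if (x \in A) && (`|f x| <= c) then f x else 0.
Proof.
rewrite /truncate indicE in_setI.
have -> : (x \in [set y | `|f y| <= c]) = (`|f x| <= c) by apply/idP/idP; rewrite inE.
by case: andP => _; rewrite ?mulr1 ?mulr0.
Qed.

Lemma measurable_truncate A c f : measurable A -> measurable_fun setT f ->
  measurable_fun setT (truncate A c f).
Proof.
move=> mA mf; apply: measurable_funM => //; apply: measurable_indic.
apply: measurableI => //.
have := (measurableT_comp (@normr_measurable R setT) mf) measurableT _ (measurable_itv `]-oo, c]).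
by congr measurable; apply/seteqP; split=> x /=; rewrite in_itv/= // => -[].
Qed.

Lemma ler_norm_truncate A c f x : `|truncate A c f x| <= `|f x|.
Proof. by rewrite truncateE; case: ifP => // _; rewrite normr0. Qed.

Lemma ler_norm_truncateB A c f x : `|f x - truncate A c f x| <= `|f x|.
Proof. by rewrite truncateE; case: ifP => // _; rewrite ?subrr ?normr0 ?subr0. Qed.

Lemma Lfun_truncate A c f : measurable A -> f \in Lfun mu p%:E ->
  truncate A c f \in Lfun mu p%:E.
Proof.
move=> mA fp; apply: (Lfun_le p1 _ fp); last exact: ler_norm_truncate.
exact: measurable_truncate (Lfun_measurable fp).
Qed.

(** At each point the difference is eventually 0, and it is dominated by [|f|]. *)
Lemma Lnorm_truncate (A : nat -> set X) f :
  (forall j, measurable (A j)) -> (forall i j, (i <= j)%N -> A i `<=` A j) ->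
  \bigcup_j A j = setT -> f \in Lfun mu p%:E ->
  N (fun x => f x - truncate (A j) j%:R f x)%R @[j --> \oo] --> 0%E.
Proof.
move=> mA ndA cA fp.
have mf := Lfun_measurable fp.
apply: (@Lnorm_dominated _ _ _ mu p p1 _ f) => //.
- by move=> j; apply: measurable_funB => //; exact: measurable_truncate.
- by move=> j x; exact: ler_norm_truncateB.
apply: aeW => x; have [i _ Aix] : (\bigcup_j A j) x by rewrite cA.
apply: cvg_near_cst; near=> j.
rewrite truncateE mem_set; last first.
  by apply: (ndA i) => //; near: j; exact: nbhs_infty_ge.
rewrite ifT ?subrr//=.
near: j; exact: nbhs_infty_ger.
Unshelve. all: by end_near. Qed.

(** By density it suffices to treat a function bounded by [j] and supported in the union [A j] of
    finitely many cubes of generation [m]. Its finer means share bound and support, so [2 * j] times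
    the indicator of [A j] dominates the difference, which tends to 0 almost everywhere. *)
Lemma condexp_cvg_Lp f m : f \in Lfun mu p%:E ->
  N (fun x => condexp D mu (m + n%:Z) f x - f x)%R @[n --> \oo] --> 0%E.
Proof.
move=> fp; have mf := Lfun_measurable fp.
pose A j := \bigcup_(i in [set i | (i < j)%N]) cube_seq D m i.
have kA j : dyadic_set D m (A j).
  by apply: dyadic_set_bigcup => i _; exact: dyadic_set_cube_seq.
have mA j : measurable (A j) := measurable_dyadic_set (kA j).
have cA : \bigcup_j A j = setT.
  rewrite -(cube_seq_cover D m); apply/seteqP; split => x.
    by move=> [j _ [i _ ix]]; exists i.
  by move=> [i _ ix]; exists i.+1 => //; exists i => //=.
have ndA i j : (i <= j)%N -> A i `<=` A j.
  by move=> ij x [n /= ni nx]; exists n => //=; exact: leq_trans ij.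
have Afin j : (mu (A j) < +oo)%E.
  rewrite /A bigcup_mkord; elim: j => [|j IH].
    by rewrite big_ord0 measure0.
  rewrite big_ord_recr/=; apply: le_lt_trans (measureU2 _ _ _) _.
  - by apply: bigsetU_measurable => i _; exact: measurable_cube_seq.
  - exact: measurable_cube_seq.
  apply: lte_add_pinfty => //.
  have [->|[a ->]] := cube_seqP D m j; last exact: cube_fin.
  by rewrite measure0 ltry.
apply: (@Lp_contraction_cvg _ _ _ mu p p1 (fun n => condexp D mu (m + n%:Z)) id f
   (fun j => truncate (A j) j%:R f)) => //.
- by move=> n; exact: Lp_contraction_condexp.
- by move=> j; exact: Lfun_truncate.
- exact: Lnorm_truncate.
move=> j; set g := truncate _ _ _; have gp : g \in Lfun mu p%:E by exact: Lfun_truncate.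
apply: (@Lnorm_dominated _ _ _ mu p p1 _ (fun x => (j%:R + j%:R) * \1_(A j) x)).
- move=> n; apply: measurable_funB; first exact: measurable_condexp.
  exact: Lfun_measurable gp.
- exact: Lfun_bounded_support.
- move=> n x.
  have gj y : `|g y| <= j%:R.
    by rewrite /g truncateE; case: ifP => [/andP[]//|]; rewrite normr0.
  have gi : mu.-integrable (dy_cube (cube_at D (m + n%:Z) x)) (EFin \o g).
    by apply: (Lfun_loc_int p1 gp) => //; exact: dy_measurable.
  rewrite indicE; case: (boolP (x \in A j)) => xA /=.
    have jj : `|j%:R + j%:R : R| = j%:R + j%:R by rewrite ger0_norm ?addr_ge0.
    rewrite mulr1 jj.
    apply: le_trans (ler_normB _ _) _; apply: lerD => //.
    by apply: norm_mean_le => //; exact: dy_measurable.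
  rewrite mulr0 normr0.
  (* [A j] is saturated for generation [m], so a finer cube containing a point outside [A j] misses
     [A j] altogether. *)
  have gx y : dy_cube (cube_at D (m + n%:Z) x) y -> g y = 0.
    move=> xy; rewrite /g truncateE ifF//; apply/negP => /andP[].
    rewrite inE => Ay _; move: xA; rewrite notin_setE; apply; apply: (kA j) Ay.
    by apply: (@cube_at_coarser _ _ _ _ D m (m + n%:Z)); rewrite ?lerDl// (cube_at_eq xy).
  rewrite gx ?subr0; last exact: cube_atP.
  apply: norm_mean_le => //; first exact: dy_measurable.
  by move=> y /gx ->; rewrite normr0.
apply: filterS (condexp_ae rho_qmetric X_borel cube_fin m p1 gp) => x /cvgrPdist_lt gx.
by apply/cvgrPdist_lt => e /gx; apply: filterS => n; rewrite sub0r opprB.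
Qed.

End Lp_convergence.

(** * Limit along coarse generations *)

Section coarse_limit.
Set Implicit Arguments.
Unset Strict Implicit.
Context {R : realType} {d} {X : measurableType d} {rho : X -> X -> R}.
Variables (D : dyadic_system rho) (mu : {measure set X -> \bar R}).
Hypothesis cube_fin : forall k (a : dy_idx D k), (mu (dy_cube a) < +oo)%E.
Implicit Types (k l m : int) (A B : set X) (f g : X -> R).

(** The distinguished point is a centre in every generation, so its cube of generation [-n] contains
    the ball of radius [c1 * delta ^ (-n)] about it, and these radii are unbounded. *)
Lemma coarse_cubes_cover : distinguished_center_point D ->
  exists x0, forall x, exists n : nat, dy_cube (cube_at D (- n%:Z) x0) x.
Proof.
move=> [x0 x0c]; exists x0 => x.
have /andP[d0 d1] := dy_delta_in D; have /andP[c10 _] := dy_c1_C1 D.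
(* The absolute value and the added 1 make [r] a positive upper bound of the distance, fit to divide
   by. *)
pose r := `|rho x0 x| + 1; have r0 : 0 < r by rewrite ltr_wpDl.
have /cvgrPdist_lt /(_ (dy_c1 D / r)) : (dy_delta D ^+ n @[n --> \oo] --> (0 : R)).
  by apply: cvg_expr; rewrite gtr0_norm.
rewrite divr_gt0// => /(_ isT)[n _ /(_ n (leqnn n))] /=.
have dn0 : 0 < dy_delta D ^+ n by rewrite exprn_gt0.
rewrite sub0r normrN gtr0_norm// ltr_pdivlMr// => nr.
exists n; have [a x0a] := x0c (- n%:Z).
have -> : cube_at D (- n%:Z) x0 = a by apply: cube_at_eq; rewrite x0a; exact: dy_center_in.
apply: dy_ball_sub; rewrite /qball/= -x0a.
rewrite -exprnN ltr_pdivlMr//; apply: le_lt_trans nr.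
rewrite mulrC ler_pM2l// /r.
by rewrite (le_trans (ler_norm _))// lerDl.
Qed.

Variable x0 : X.
Hypothesis x0_cover : forall x, exists n : nat, dy_cube (cube_at D (- n%:Z) x0) x.
Variable p : R.
Hypothesis p_gt1 : 1 < p.
Local Notation N u := ('N[mu]_p%:E[EFin \o u])%E.

Let p0 : 0 < p. Proof. exact: lt_trans p_gt1. Qed.
Let p1 : 1 <= p. Proof. exact: ltW. Qed.

Let Q (n : nat) := dy_cube (cube_at D (- n%:Z) x0).

Let mQ n : measurable (Q n). Proof. exact: dy_measurable. Qed.

Let Qfin n : (mu (Q n) < +oo)%E. Proof. exact: cube_fin. Qed.

Let QS i j : (i <= j)%N -> Q i `<=` Q j.
Proof. by move=> ij; apply: cube_at_sub; rewrite lerN2 lez_nat. Qed.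

Let QT : \bigcup_n Q n = setT.
Proof. by rewrite -subTset => x _; have [n nx] := x0_cover x; exists n. Qed.

Let mu_Q : mu (Q n) @[n --> \oo] --> mu setT.
Proof.
rewrite -QT; apply: nondecreasing_cvg_mu => //; first by rewrite QT.
by move=> i j ij; apply/subsetPset/QS.
Qed.

Let mu_Q_ge (M : R) : mu setT = +oo%E ->
  \forall n \near \oo, M <= fine (mu (Q n)).
Proof.
move=> muT; have := mu_Q; rewrite muT => /cvgeyPge /(_ M).
apply: filterS => n.
by rewrite -{1}(@fineK _ (mu (Q n))) ?lee_fin// ge0_fin_numE.
Qed.

(** Jensen bounds the p-th power of the mean times [mu (Q n)] by the integral [K] of [|f| ^ p],
    while [mu (Q n)] tends to infinity. *)
Let mean_Q_infty f : mu setT = +oo%E -> f \in Lfun mu p%:E ->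
  mean mu (Q n) f @[n --> \oo] --> 0.
Proof.
move=> muT fp; have If : (\int[mu]_x (`|f x| `^ p)%:E)%E \is a fin_num.
  by apply: integrable_fin_num => //; exact: Lfun_integrable.
pose K := fine (\int[mu]_x (`|f x| `^ p)%:E)%E.
apply/cvgrPdist_le => e e0.
have ep : 0 < e `^ p by rewrite powR_gt0.
near=> n; rewrite sub0r normrN.
(* The quotient gives [K <= e ^ p * mu (Q n)]; the added 1 keeps [mu (Q n)] positive for the later
   cancellation. *)
have nK : K / (e `^ p) + 1 <= fine (mu (Q n)) by near: n; exact: mu_Q_ge.
have K0 : 0 <= K.
  by rewrite fine_ge0// integral_ge0// => x _; rewrite lee_fin powR_ge0.
have : (`|mean mu (Q n) f| `^ p * fine (mu (Q n)) <= e `^ p * fine (mu (Q n))).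
  apply: (@le_trans _ _ K).
    rewrite -lee_fin EFinM (fineK If) fineK ?ge0_fin_numE//.
    apply: le_trans (jensen_mean p_gt1 (mQ n) (Qfin n) fp) _.
    apply: ge0_subset_integral => //.
    exact: measurable_normr_powR (Lfun_measurable fp).
  rewrite mulrC -ler_pdivrMr//; apply: le_trans nK; by rewrite lerDl.
rewrite ler_pM2r; last first.
  by apply: lt_le_trans nK; rewrite ltr_wpDl// divr_ge0// ltW.
have [//|lt_e] := leP `|mean mu (Q n) f| e.
rewrite leNgt => /negP[].
by rewrite gt0_ltr_powR// ?nnegrE// ltW.
Unshelve. all: by end_near. Qed.

Let mean_Q_fin f : (mu setT < +oo)%E -> f \in Lfun mu p%:E ->
  mean mu (Q n) f @[n --> \oo] --> mean mu setT f.
Proof.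
move=> muT fp.
(* If [X] is null, all means are 0 by convention; otherwise inversion is continuous at [mu setT] and
   numerator and denominator converge separately. *)
have [T0|T0] := eqVneq (mu setT) 0%E.
  have A0 A : measurable A -> mean mu A f = 0.
    move=> mA; rewrite /mean (_ : mu A = 0%E) ?invr0 ?mul0r//.
    by apply/eqP; rewrite -measure_le0 -T0 le_measure ?inE.
  by rewrite A0//; under eq_fun do rewrite A0//; exact: cvg_cst.
have fi : mu.-integrable setT (EFin \o f) by exact: (Lfun_loc_int p1 fp).
have Tfin : mu setT \is a fin_num by rewrite ge0_fin_numE.
apply: cvgM.
  apply: cvgV; first by rewrite fine_eq0.
  by apply: fine_cvg; rewrite fineK//; exact: mu_Q.
apply: fine_cvg; rewrite fineK; last exact: integrable_fin_num.
have [] := @dominated_convergence _ X R mu setT measurableT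
  (fun n => (EFin \o f) \_ (Q n)) (EFin \o f) (abse \o (EFin \o f)).
- move=> n; apply/(measurable_restrictT _ (mQ n)).
  by apply: measurable_funTS; case/integrableP: fi.
- by case/integrableP: fi.
- apply: aeW => x _; apply: cvg_near_cst; have [i Qix] := x0_cover x.
  near=> n; rewrite patchT// inE; apply: (QS (i := i)) => //.
  by near: n; exact: nbhs_infty_ge.
- exact: integrable_abse.
- apply: aeW => x n _; rewrite /patch; case: ifP => _ /=; rewrite lee_fin ?lexx ?normr0 ?normr_ge0//.
move=> _ _; apply: cvg_trans; apply: near_eq_cvg; apply: nearW => n.
by rewrite [RHS]integral_mkcond.
Unshelve. all: by end_near. Qed.

Lemma space_mean_fin f : (mu setT < +oo)%E -> space_mean mu f = mean mu setT f.
Proof. by move=> muT; rewrite /space_mean lt_eqF. Qed.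

Lemma space_mean_infty f : mu setT = +oo%E -> space_mean mu f = 0.
Proof. by move=> muT; rewrite /space_mean muT eqxx. Qed.

(** Every point lies in [Q n] for all large [n], where [E f] is the mean over [Q n]; hence the limit
    holds at every point. *)
Lemma condexp_coarse_cvg f x : f \in Lfun mu p%:E ->
  condexp D mu (- n%:Z) f x @[n --> \oo] --> space_mean mu f.
Proof.
move=> fp.
have : mean mu (Q n) f @[n --> \oo] --> space_mean mu f.
  have [muT|muT] := eqVneq (mu setT) +oo%E.
    by rewrite space_mean_infty//; exact: mean_Q_infty.
  by rewrite space_mean_fin ?ltey//; apply: mean_Q_fin => //; rewrite ltey.
apply: cvg_trans; apply: near_eq_cvg; have [i Qix] := x0_cover x.
near=> n; apply/esym/condexpE; apply: (QS (i := i)) => //.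
by near: n; exact: nbhs_infty_ge.
Unshelve. all: by end_near. Qed.

Lemma Lp_contraction_space_mean :
  Lp_contraction mu p (fun f => cst (space_mean mu f)).
Proof.
have [muT|muT] := eqVneq (mu setT) +oo%E.
  have L0 : (cst 0 : X -> R) \in Lfun mu p%:E.
    by apply/LfunE => //; rewrite Lnorm0 ?eqe ?gt_eqF//; split.
  move=> f g fp gp; rewrite !space_mean_infty//; split => //.
    by apply/funext => x /=; rewrite subr0.
  by rewrite Lnorm0 ?Lnorm_ge0// eqe gt_eqF.
have Tfin : (mu setT < +oo)%E by rewrite ltey.
move=> f g fp gp; rewrite !space_mean_fin//.
have le : (N (cst (mean mu setT f)) <= N f)%E.
  apply: (le_Lnorm_powR p1).
  apply: le_trans (jensen_mean p_gt1 measurableT Tfin fp).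
  by rewrite -integral_cst.
split => //.
  by apply/LfunE => //; split => //; apply: le_lt_trans le _; have /LfunE[] := fp.
apply/funext => x; apply: meanB => //; exact: (Lfun_loc_int p1 _ measurableT Tfin).
Qed.

(** With finite total measure constants belong to L^p, so for truncations bounded by [j] the
    constant [2 * j] dominates. *)
Let condexp_coarse_Lp_fin f : (mu setT < +oo)%E -> f \in Lfun mu p%:E ->
  N (fun x => condexp D mu (- n%:Z) f x - space_mean mu f)%R @[n --> \oo] --> 0%E.
Proof.
move=> muT fp.
apply: (@Lp_contraction_cvg _ _ _ mu p p1 (fun n => condexp D mu (- n%:Z))
   (fun f => cst (space_mean mu f)) f (fun j => truncate setT j%:R f)) => //.
- by move=> n; exact: Lp_contraction_condexp.
- exact: Lp_contraction_space_mean.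
- by move=> j; exact: Lfun_truncate.
- by apply: (@Lnorm_truncate _ _ _ mu p p_gt1 (fun=> setT)) => //; rewrite bigcup_const.
move=> j; set g := truncate _ _ _; have gp : g \in Lfun mu p%:E by exact: Lfun_truncate.
have gj y : `|g y| <= j%:R.
  by rewrite /g truncateE; case: ifP => [/andP[]//|]; rewrite normr0.
have gi A : measurable A -> (mu A < +oo)%E -> mu.-integrable A (EFin \o g).
  exact: (Lfun_loc_int p1 gp).
apply: (@Lnorm_dominated _ _ _ mu p p1 _ (fun x => (j%:R + j%:R) * \1_(setT : set X) x)).
- by move=> n; apply: measurable_funB => //; exact: measurable_condexp.
- exact: Lfun_bounded_support.
- move=> n x; rewrite indicE in_setT mulr1.
  have jj : `|j%:R + j%:R : R| = j%:R + j%:R by rewrite ger0_norm ?addr_ge0.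
  rewrite jj; apply: le_trans (ler_normB _ _) _; apply: lerD.
    apply: norm_mean_le => //; first exact: dy_measurable.
    by apply: gi => //; exact: dy_measurable.
  by rewrite /= space_mean_fin//; apply: norm_mean_le => //; exact: gi.
apply: aeW => x; have /cvgrPdist_lt gx := condexp_coarse_cvg x gp.
by apply/cvgrPdist_lt => e /gx; apply: filterS => n; rewrite sub0r opprB.
Qed.

Let condexp_coarse_Lp_infty f : mu setT = +oo%E -> f \in Lfun mu p%:E ->
  N (fun x => condexp D mu (- n%:Z) f x - space_mean mu f)%R @[n --> \oo] --> 0%E.
Proof.
move=> muT fp.
apply: (@Lp_contraction_cvg _ _ _ mu p p1 (fun n => condexp D mu (- n%:Z))
   (fun f => cst (space_mean mu f)) f (fun j => truncate (Q j) j%:R f)) => //.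
- by move=> n; exact: Lp_contraction_condexp.
- exact: Lp_contraction_space_mean.
- by move=> j; exact: Lfun_truncate.
- exact: Lnorm_truncate.
move=> j; set g := truncate _ _ _; have gp : g \in Lfun mu p%:E by exact: Lfun_truncate.
rewrite space_mean_infty//.
pose c := \int[mu]_(y in Q j) g y.
(* Since [g] is supported in [Q j], once [Q n] contains [Q j] every other cube of that generation
   misses the support, and the mean over [Q n] has the fixed numerator [c]. *)
have gE (n : nat) x : (j <= n)%N -> condexp D mu (- n%:Z) g x - 0 =
    c / fine (mu (Q n)) * \1_(Q n) x.
  move=> jn; rewrite subr0 indicE; case: (boolP (x \in Q n)) => [|xQ].
    rewrite inE => xQ; rewrite (condexpE _ _ xQ) mulr1 /mean mulrC; congr (_ / _).
    rewrite /c [LHS]Rintegral_mkcond [RHS]Rintegral_mkcond; apply: eq_Rintegral => y _.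
    rewrite /patch; case: (boolP (y \in Q j)) => yj.
      by rewrite mem_set//; apply: (QS jn); rewrite inE in yj.
    by rewrite /g truncateE (negbTE yj)/= if_same.
  rewrite mulr0 (_ : condexp _ _ _ _ _ = 0)//.
  rewrite /condexp /mean (@eq_Rintegral _ _ _ _ _ (cst 0)).
    by rewrite /Rintegral integral0 mulr0.
  move=> y; rewrite inE => /cube_at_eq xy; rewrite /g truncateE ifF//.
  apply/negP => /andP[]; rewrite inE => /(QS jn) /cube_at_eq yQ _.
  move: xQ; rewrite notin_setE; apply; rewrite /Q -yQ xy; exact: cube_atP.
apply: Lnorm_cvg0 => e e0.
have q0 : 0 < p - 1 by rewrite subr_gt0.
near=> n; have jn : (j <= n)%N by near: n; exact: nbhs_infty_ge.
(* Solving [(|c| / M) ^ p * M <= e ^ p] for [M] gives this threshold; the added 1 ensures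
   [M > 0]. *)
have Mn : (`|c| / e) `^ (p / (p - 1)) + 1 <= fine (mu (Q n)).
  by near: n; exact: mu_Q_ge.
set M := fine (mu (Q n)) in Mn.
have M0 : 0 < M by apply: lt_le_trans Mn; rewrite ltr_wpDl// powR_ge0.
apply: (Lnorm_le_powR p1); first exact: ltW.
rewrite (eq_integral (fun x => ((`|c| / M) `^ p * \1_(Q n) x)%:E)); last first.
  move=> x _; rewrite gE// -/M normrM powRM//.
  congr (_ * _)%:E; first by rewrite normrM normfV (gtr0_norm M0).
  rewrite indicE; case: (_ \in _); first by rewrite normr1 powR1.
  by rewrite normr0 powR0// gt_eqF.
under eq_integral do rewrite EFinM.
have m1 : measurable_fun setT (fun x => (\1_(Q n) x : R)%:E).
  exact/measurable_EFinP/measurable_indic.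
rewrite (ge0_integralZl_EFin _ _ _ m1)//; last by rewrite powR_ge0.
rewrite integral_indic// setIT -(@fineK _ (mu (Q n))) ?ge0_fin_numE// -/M -EFinM lee_fin.
rewrite powRM ?invr_ge0 ?(ltW M0)// -powR_inv1 ?(ltW M0)// -powRrM mulN1r powRN.
rewrite -(mulr_powRB1 (ltW M0) p0) invfM (mulrC M^-1) mulrA divfK ?gt_eqF//.
rewrite ler_pdivrMr ?powR_gt0//.
have -> : `|c| = e * (`|c| / e) by rewrite mulrC divfK// gt_eqF.
rewrite powRM ?divr_ge0 ?(ltW e0)// ler_pM2l ?powR_gt0//.
have -> : (`|c| / e) `^ p = ((`|c| / e) `^ (p / (p - 1))) `^ (p - 1).
  by rewrite -powRrM divfK// gt_eqF.
have KM : (`|c| / e) `^ (p / (p - 1)) <= M by apply: le_trans Mn; rewrite lerDl.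
by rewrite ge0_ler_powR ?nnegrE ?powR_ge0// ltW.
Unshelve. all: by end_near. Qed.

Lemma condexp_coarse_Lp f : f \in Lfun mu p%:E ->
  N (fun x => condexp D mu (- n%:Z) f x - space_mean mu f)%R @[n --> \oo] --> 0%E.
Proof.
move=> fp; have [muT|muT] := eqVneq (mu setT) +oo%E.
  exact: condexp_coarse_Lp_infty.
by apply: condexp_coarse_Lp_fin => //; rewrite ltey.
Qed.

End coarse_limit.

(** * Haar sums as differences of means *)

Section haar_identity.
Set Implicit Arguments.
Unset Strict Implicit.
Context {R : realType} {d} {X : measurableType d} {rho : X -> X -> R}.
Variables (D : dyadic_system rho) (mu : {measure set X -> \bar R}).
Hypothesis cube_fin : forall k (a : dy_idx D k), (mu (dy_cube a) < +oo)%E.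
Variable ch : forall k, dy_idx D k -> nat -> dy_idx D (k + 1).
Hypothesis ch_ordering : haar_ordering mu ch.
Variable f : X -> R.
Hypothesis f_int : forall k (a : dy_idx D k), mu.-integrable (dy_cube a) (EFin \o f).
Implicit Types (k l m : int) (A B : set X).

(** Here [q] and [e] stand for the measures of [Q_u] and [E_(u+1)], [F] and [G] for the integrals of
    [f] over them, and [al], [- be] are the values of the Haar function. The square roots disappear
    because only the products [al * al], [al * be] and [be * be] occur. *)
Lemma haar_algebra (q e F G : R) : 0 < q -> 0 < e ->
  let al := Num.sqrt e / (Num.sqrt q * Num.sqrt (q + e)) in
  let be := Num.sqrt q / (Num.sqrt (q + e) * Num.sqrt e) in
  (al * F - be * G) * al = F / q - (F + G) / (q + e) /\
  (al * F - be * G) * - be = G / e - (F + G) / (q + e).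
Proof.
move=> q0 e0 al be; have qe0 := addr_gt0 q0 e0.
have [sq0 se0 sqe0] : [/\ Num.sqrt q != 0, Num.sqrt e != 0 & Num.sqrt (q + e) != 0].
  by split; rewrite gt_eqF// sqrtr_gt0.
have sqrt2 (r : R) : 0 < r -> Num.sqrt r * Num.sqrt r = r.
  by move=> r0; rewrite -expr2 sqr_sqrtr// ltW.
have alal : al * al = e / (q * (q + e)).
  by rewrite /al mulf_div mulrACA !sqrt2.
have bebe : be * be = q / ((q + e) * e).
  by rewrite /be mulf_div mulrACA !sqrt2.
have albe : al * be = (q + e)^-1.
  rewrite -[in RHS](sqrt2 _ qe0) /al /be; field.
  by rewrite sq0 se0 sqe0.
split.
  have -> : (al * F - be * G) * al = (al * al) * F - (al * be) * G by ring.
  by rewrite alal albe; field; rewrite !gt_eqF.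
have -> : (al * F - be * G) * - be = (be * be) * G - (al * be) * F by ring.
by rewrite bebe albe; field; rewrite !gt_eqF.
Qed.

Lemma pairing_indicB (A B : set X) (al be : R) : measurable A -> measurable B ->
  mu.-integrable A (EFin \o f) -> mu.-integrable B (EFin \o f) ->
  pairing mu f (fun x => al * \1_A x - be * \1_B x) =
  al * \int[mu]_(x in A) f x - be * \int[mu]_(x in B) f x.
Proof.
move=> mA mB fA fB; rewrite /pairing.
have ind C x : (f \_ C) x = f x * \1_C x.
  by rewrite /patch indicE; case: ifP; rewrite ?mulr1 ?mulr0.
have intC C : measurable C -> mu.-integrable C (EFin \o f) ->
    mu.-integrable setT (EFin \o (f \_ C)).
  move=> mC fC; have /(integrable_mkcond _ mC).1 := fC.
  congr (_.-integrable _ _); apply/funext => x /=; rewrite /patch; by case: ifP.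
rewrite (Rintegral_mkcond mu A) (Rintegral_mkcond mu B).
rewrite -RintegralZl//; last exact: intC.
rewrite -RintegralZl//; last exact: intC.
rewrite -RintegralB//.
- apply: eq_Rintegral => x _; rewrite !ind; ring.
- exact: (integrableZl measurableT al (intC _ mA fA)).
- exact: (integrableZl measurableT be (intC _ mB fB)).
Qed.

(** * Telescoping of the Haar terms on one cube *)

Section one_cube.
Variables (k : int) (a : dy_idx D k).
Let M := nchildren a.
Let Q u := dy_cube (ch a u).
Let E u := child_tail ch a u.

Let mQ u : measurable (Q u). Proof. exact: dy_measurable. Qed.

Let ch_sub u : (1 <= u <= M)%N -> Q u `<=` dy_cube a.
Proof. by move=> uM; have [[H _ _] _] := ch_ordering a; exact: (H u uM). Qed.

Let ch_cover x : dy_cube a x -> exists2 u, (1 <= u <= M)%N & Q u x.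
Proof.
have [[_ _ H] _] := ch_ordering a.
by rewrite dy_union => -[b /H[u /= uM <-] bx]; exists u.
Qed.

Let ch_uniq u v x : (1 <= u <= M)%N -> (1 <= v <= M)%N -> Q u x -> Q v x -> u = v.
Proof.
have [[_ inj _] _] := ch_ordering a.
move=> uM vM ux vx; apply: inj; rewrite ?inE//.
by rewrite -(cube_at_eq ux) (cube_at_eq vx).
Qed.

Let mE u : measurable (E u).
Proof. by apply: bigcup_measurable => j _; exact: mQ. Qed.

Let E_sub u : (1 <= u)%N -> E u `<=` dy_cube a.
Proof.
move=> u1 x [j /andP[uj jM] jx]; apply: (ch_sub _ jx).
by rewrite (leq_trans u1 uj).
Qed.

Let E_split u : (1 <= u <= M)%N -> E u = Q u `|` E u.+1.
Proof.
move=> /andP[u1 uM]; apply/seteqP; split => x.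
  move=> [j /andP[uj jM] jx]; move: uj; rewrite leq_eqVlt => /predU1P[->|uj].
    by left.
  by right; exists j => //; apply/andP.
move=> [ux|[j /andP[uj jM] jx]]; first by exists u => //=; rewrite leqnn.
by exists j => //=; rewrite jM ltnW.
Qed.

Let E_disj u : (1 <= u <= M)%N -> [disjoint Q u & E u.+1].
Proof.
move=> uM; apply/disj_setPS => x [ux [j /andP[uj jM] jx]].
have := @ch_uniq u j x uM _ ux jx; rewrite jM (leq_trans _ uj)// => /(_ isT) uj'.
by move: uj; rewrite uj' ltnn.
Qed.

Let E1 : E 1 = dy_cube a.
Proof.
apply/seteqP; split; first exact: E_sub.
by move=> x /ch_cover[u uM ux]; exists u.
Qed.

Let EM : (1 <= M)%N -> E M = Q M.
Proof.
move=> M1; rewrite E_split ?M1 ?leqnn// [E _](_ : _ = set0) ?setU0//.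
by rewrite -subset0 => x [j /andP[]]; rewrite ltnNge => /negP.
Qed.

Let E_fin u : (1 <= u)%N -> (mu (E u) < +oo)%E.
Proof.
move=> u1; apply: le_lt_trans (cube_fin a); apply: le_measure; rewrite ?inE//.
  exact: dy_measurable.
exact: E_sub.
Qed.

(** The inequality of the ordering enters here: its coefficient [1 - (u - 1) / M] is positive for
    [u <= M], so a null tail would make the whole cube null. *)
Let E_pos u : mu (dy_cube a) != 0%E -> (1 <= u <= M)%N -> 0 < fine (mu (E u)).
Proof.
move=> a0 uM; have /andP[u1 uM'] := uM.
rewrite fine_gt0// E_fin// andbT lt0e measure_ge0 andbT.
apply: contra a0 => /eqP Eu0.
have [_ /(_ u uM)] := ch_ordering a.
rewrite big_nat_cond big1 => [|j /andP[/andP[uj jM] _]]; last first.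
  apply/eqP; rewrite -measure_le0 -Eu0; apply: le_measure; rewrite ?inE.
  - exact: mQ.
  - exact: mE.
  - by move=> x jx; exists j => //=; rewrite uj -ltnS jM.
have M0 : (0 : R) < (nchildren a)%:R by rewrite ltr0n (leq_trans u1).
have c0 : 0 < 1 - u.-1%:R / (nchildren a)%:R :> R.
  rewrite subr_gt0 ltr_pdivrMr// mul1r ltr_nat.
  by case: u u1 uM' {uM Eu0} => //= u _.
move=> H; rewrite -measure_le0; move: H.
by rewrite -{1}[0%E](mule0 (1 - u.-1%:R / (nchildren a)%:R)%:E) lee_pmul2l.
Qed.

Let f_sub A : measurable A -> A `<=` dy_cube a -> mu.-integrable A (EFin \o f).
Proof. by move=> mA Aa; apply: integrableS (f_int a) => //; exact: dy_measurable. Qed.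

Let muE u : (1 <= u <= M)%N ->
  fine (mu (E u)) = fine (mu (Q u)) + fine (mu (E u.+1)).
Proof.
move=> uM; rewrite {1}E_split// measureU//; last by apply/disj_set2P; exact: E_disj.
by rewrite fineD// ge0_fin_numE//; [exact: cube_fin|exact: E_fin].
Qed.

Let intE u : (1 <= u <= M)%N ->
  \int[mu]_(x in E u) f x = \int[mu]_(x in Q u) f x + \int[mu]_(x in E u.+1) f x.
Proof.
move=> uM; have /andP[u1 _] := uM.
rewrite {1}E_split// Rintegral_setU//; last exact: E_disj.
by rewrite -E_split//; apply: f_sub => //; exact: E_sub.
Qed.

Lemma haar_term0 u x : ~ dy_cube a x -> (1 <= u < M)%N -> haar mu ch a u x = 0.
Proof.
move=> nax /andP[u1 uM]; rewrite /haar gtn_eqF//.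
have nQ : x \in Q u = false.
  by apply/negbTE; rewrite notin_setE => /ch_sub ax; apply: nax; apply: ax; rewrite u1 ltnW.
have nE : x \in E u.+1 = false.
  by apply/negbTE; rewrite notin_setE => /E_sub ax; apply: nax; exact: ax.
by case: ifP => // _; rewrite !indicE nQ nE !mulr0 subr0.
Qed.

Lemma haar_cube_outside x : ~ dy_cube a x -> haar_cube mu ch f a x = 0.
Proof.
move=> nax; rewrite /haar_cube big_nat_cond big1// => u /andP[uM _].
by rewrite haar_term0 ?mulr0.
Qed.

(** If [Q u] is null the Haar function is 0, and [E u] and [E u.+1] have the same mean, so the
    identity on [E u.+1] survives as [0 = 0]. *)
Lemma haar_term u x : mu (dy_cube a) != 0%E -> (1 <= u < M)%N ->
  (Q u x -> mu (Q u) != 0%E ->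
    pairing mu f (haar mu ch a u) * haar mu ch a u x =
    mean mu (Q u) f - mean mu (E u) f) /\
  (E u.+1 x -> pairing mu f (haar mu ch a u) * haar mu ch a u x =
    mean mu (E u.+1) f - mean mu (E u) f).
Proof.
move=> a0 /andP[u1 uM]; have uM' : (1 <= u <= M)%N by rewrite u1 ltnW.
have e0 : 0 < fine (mu (E u.+1)) by exact: E_pos.
have Qint := f_sub (mQ u) (ch_sub uM').
have Eint := f_sub (mE u.+1) (@E_sub u.+1 isT).
have hE : haar mu ch a u = if mu (Q u) == 0%E then cst 0 else
    (fun y => Num.sqrt (fine (mu (E u.+1))) /
        (Num.sqrt (fine (mu (Q u))) * Num.sqrt (fine (mu (E u)))) * \1_(Q u) y
      - Num.sqrt (fine (mu (Q u))) /
        (Num.sqrt (fine (mu (E u))) * Num.sqrt (fine (mu (E u.+1)))) *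
        \1_(E u.+1) y).
  by apply/funext => y; rewrite /haar gtn_eqF// -/(Q u); case: (mu (Q u) == 0%E).
rewrite hE /mean (muE uM') (intE uM').
have [q0|q0] := eqVneq (mu (Q u)) 0%E.
  split=> // _; rewrite mulr0 q0 add0r.
  rewrite (_ : \int[mu]_(y in Q u) f y = 0) ?add0r ?subrr//.
  by rewrite /Rintegral null_set_integral//; case/integrableP: Qint.
have q1 : 0 < fine (mu (Q u)) by rewrite fine_gt0// lt0e q0 measure_ge0 cube_fin.
rewrite pairing_indicB//.
have [H1 H2] := haar_algebra (\int[mu]_(y in Q u) f y) (\int[mu]_(y in E u.+1) f y) q1 e0.
split=> [ux _|ex].
  have nE : x \in E u.+1 = false.
    apply/negbTE; rewrite notin_setE => ex.
    by have /disj_setPS/(_ x) := E_disj uM'; apply.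
  by rewrite !indicE (mem_set ux) nE mulr1 mulr0 subr0 H1 !(mulrC _^-1).
have nQ : x \in Q u = false.
  apply/negbTE; rewrite notin_setE => ux.
  by have /disj_setPS/(_ x) := E_disj uM'; apply.
by rewrite !indicE (mem_set ex) nQ mulr1 mulr0 sub0r H2 !(mulrC _^-1).
Qed.

(* On a null child the Haar sum need not vanish, whence the restriction on [x]. *)
Lemma haar_cubeE x : dy_cube a x -> mu (dy_cube (cube_at D (k + 1) x)) != 0%E ->
  haar_cube mu ch f a x = condexp D mu (k + 1) f x - condexp D mu k f x.
Proof.
move=> ax x0; have [v vM vx] := ch_cover ax; have /andP[v1 vM'] := vM.
have Qv : dy_cube (cube_at D (k + 1) x) = Q v by rewrite (cube_at_eq vx).
rewrite Qv in x0.
rewrite (condexpE _ _ vx) (condexpE _ _ ax) -/(Q v).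
have a0 : mu (dy_cube a) != 0%E.
  apply: contra x0 => /eqP a0; rewrite -measure_le0 -a0 le_measure ?inE//.
    exact: dy_measurable.
  exact: ch_sub.
rewrite /haar_cube -/M -E1.
(* With [x] in the child [Q v], the terms [u < v] see [x] in [E u.+1] and telescope, the term [v]
   passes from [E v] to [Q v], and the terms [u > v] vanish at [x]. *)
have low : \sum_(1 <= u < v) pairing mu f (haar mu ch a u) * haar mu ch a u x =
    mean mu (E v) f - mean mu (E 1) f.
  rewrite -(telescope_sumr (fun u => mean mu (E u) f))//.
  apply: eq_big_nat => u /andP[u1 uv].
  apply: (haar_term x a0 _).2; first by rewrite u1 (leq_trans uv).
  by exists v => //=; rewrite uv.
(* The last child has no Haar term of its own, but there [E M] is already [Q M]. *)
move: vM'; rewrite leq_eqVlt => /predU1P[vM'|vM'].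
  by rewrite -vM' low {1}vM' EM -?vM'.
rewrite (big_cat_nat v1 (ltnW vM'))/= low big_ltn//.
rewrite (haar_term x a0 _).1 ?v1//.
rewrite big_nat_cond big1 ?addr0; first by ring.
move=> u /andP[/andP[vu uM] _]; rewrite (_ : haar _ _ _ _ _ = 0) ?mulr0//.
have u1 : (1 <= u)%N := leq_ltn_trans (leq0n v) vu.
have nj j : (v < j)%N -> (j <= M)%N -> ~ Q j x.
  move=> vj jM jx; have := ch_uniq vM _ vx jx.
  by rewrite jM (leq_ltn_trans _ vj)// => /(_ isT) vj'; rewrite vj' ltnn in vj.
rewrite /haar gtn_eqF//; case: ifP => // _.
rewrite !indicE memNset ?memNset ?mulr0 ?subr0//.
  by move=> [j /andP[uj jM] jx]; apply: (nj j) => //; exact: ltn_trans uj.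
exact: nj (ltnW uM).
Qed.

Lemma measurable_haar_cube : measurable_fun setT (haar_cube mu ch f a).
Proof.
apply: measurable_sum => u; apply: measurable_funM => //.
rewrite /haar; case: (u == 0%N).
  by apply: measurable_funM => //; apply: measurable_indic; exact: dy_measurable.
case: (mu _ == 0%E) => //; apply: measurable_funB.
  by apply: measurable_funM => //; apply: measurable_indic; exact: mQ.
by apply: measurable_funM => //; apply: measurable_indic; exact: (mE u.+1).
Qed.

End one_cube.

(** The two factors [mu(Q) ^ (-1/2)] combine to [mu(Q) ^ (-1)]. Null cubes are no exception, as both
    sides are then 0 by convention. *)
Lemma haar_averageE k x : haar_average mu ch f k x = condexp D mu k f x.
Proof.
rewrite /haar_average -(fsbig_widen [set cube_at D k x]) => [|//|a [_ nxa]]; last first.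
  rewrite {2}/haar/= indicE memNset ?mulr0// => /cube_at_eq xa.
  by apply: nxa; rewrite /= xa.
rewrite fsbig_set1 /condexp; set a := cube_at D k x.
have ax : dy_cube a x by exact: cube_atP.
have ma := @dy_measurable _ _ _ _ D k a.
have -> : haar mu ch a 0 = (fun y => (Num.sqrt (fine (mu (dy_cube a))))^-1 * \1_(dy_cube a) y
    - 0 * \1_(dy_cube a) y).
  by apply/funext => y; rewrite /haar/= mul0r subr0.
rewrite pairing_indicB// indicE mem_set// !mul0r !subr0 mulr1 mulrAC -invfM.
by rewrite -expr2 sqr_sqrtr// fine_ge0.
Qed.

Lemma haar_layer_cube k x :
  haar_layer mu ch f k x = haar_cube mu ch f (cube_at D k x) x.
Proof.
rewrite /haar_layer -(fsbig_widen [set cube_at D k x]) => [|//|a [_ nxa]].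
  by rewrite fsbig_set1.
by apply: haar_cube_outside => /cube_at_eq xa; apply: nxa; rewrite /= xa.
Qed.

Lemma haar_layerE k x : mu (dy_cube (cube_at D (k + 1) x)) != 0%E ->
  haar_layer mu ch f k x = condexp D mu (k + 1) f x - condexp D mu k f x.
Proof. by move=> x0; rewrite haar_layer_cube haar_cubeE//; exact: cube_atP. Qed.

(** Only the cube containing [x] contributes at [x]. Consequently the layer dominates all its
    partial sums. *)
Lemma haar_partial_sumE k (A : {fset dy_idx D k}) x :
  \sum_(a <- A) haar_cube mu ch f a x =
  if cube_at D k x \in A then haar_layer mu ch f k x else 0.
Proof.
have out a : a != cube_at D k x -> haar_cube mu ch f a x = 0.
  by move=> ax; apply: haar_cube_outside => /cube_at_eq xa; rewrite xa eqxx in ax.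
case: ifPn => xA; last first.
  by rewrite big_seq big1// => a aA; apply: out; apply: contraNneq xA => <-.
rewrite (big_fsetD1 (cube_at D k x))//= haar_layer_cube big_seq big1 ?addr0// => a.
by rewrite !inE => /andP[ax _]; exact: out.
Qed.

Lemma measurable_haar_layer k : measurable_fun setT (haar_layer mu ch f k).
Proof.
rewrite -(cube_seq_cover D k).
apply/measurable_fun_bigcup => [n|n]; first exact: measurable_cube_seq.
case: (cube_seqP D k n) => [->|[a ->]]; first exact: measurable_fun_set0.
apply: (eq_measurable_fun (haar_cube mu ch f a)).
  by move=> x; rewrite inE => ax; rewrite haar_layer_cube (cube_at_eq ax).
by apply: measurable_funTS; exact: measurable_haar_cube.
Qed.

End haar_identity.

(** * Haar layers in Lp *)

Section haar_expansion.
Set Implicit Arguments.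
Unset Strict Implicit.
Context {R : realType} {d} {X : measurableType d} {rho : X -> X -> R}.
Variables (D : dyadic_system rho) (mu : {measure set X -> \bar R}).
Hypothesis cube_fin : forall k (a : dy_idx D k), (mu (dy_cube a) < +oo)%E.
Variable ch : forall k, dy_idx D k -> nat -> dy_idx D (k + 1).
Hypothesis ch_ordering : haar_ordering mu ch.
Variable p : R.
Hypothesis p_gt1 : 1 < p.
Variable f : X -> R.
Hypothesis fp : f \in Lfun mu p%:E.
Implicit Types (k l m : int).
Local Notation N u := ('N[mu]_p%:E[EFin \o u])%E.

Let p1 : 1 <= p. Proof. exact: ltW. Qed.

Let f_int k (a : dy_idx D k) : mu.-integrable (dy_cube a) (EFin \o f).
Proof. by apply: (Lfun_loc_int p1 fp) => //; exact: dy_measurable. Qed.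

Lemma haar_layer_sum m n x :
  (forall k, mu (dy_cube (cube_at D k x)) != 0%E) ->
  \sum_(0 <= i < n) haar_layer mu ch f (m + i%:Z) x =
  condexp D mu (m + n%:Z) f x - condexp D mu m f x.
Proof.
move=> x0.
have := telescope_sumr (fun i : nat => condexp D mu (m + i%:Z) f x) (leq0n n).
rewrite addr0 => <-; apply: eq_big_nat => i _; rewrite haar_layerE//.
by rewrite -addrA -PoszD addn1.
Qed.

(** Almost everywhere the layer is a difference of two conditional expectations in L^p; its
    measurability comes separately, from its formula on each cube. *)
Lemma Lfun_haar_layer k : haar_layer mu ch f k \in Lfun mu p%:E.
Proof.
have ml := measurable_haar_layer ch_ordering f k.
have dL := LfunB p1 (Lfun_condexp cube_fin p_gt1 (k + 1) fp)
  (Lfun_condexp cube_fin p_gt1 k fp).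
apply: (Lfun_ae_eq ml dL).
apply: filterS (ae_nonnull_cubes D mu) => x x0.
exact: haar_layerE.
Qed.

Lemma Lfun_haar_layer_sum m n :
  (fun x => \sum_(0 <= i < n) haar_layer mu ch f (m + i%:Z) x) \in Lfun mu p%:E.
Proof.
elim: n => [|n IH].
  have -> : (fun x => \sum_(0 <= i < 0) haar_layer mu ch f (m + i%:Z) x) =
      (fun x => f x - f x).
    by apply/funext => x; rewrite big_nil subrr.
  exact: LfunB.
have -> : (fun x => \sum_(0 <= i < n.+1) haar_layer mu ch f (m + i%:Z) x) =
    (fun x => \sum_(0 <= i < n) haar_layer mu ch f (m + i%:Z) x +
              haar_layer mu ch f (m + n%:Z) x).
  by apply/funext => x; rewrite big_nat_recr.
exact: LfunD IH (Lfun_haar_layer _).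
Qed.

(** A partial sum containing all cubes with code below [n] can differ from the layer only on
    [far n], the union of the other cubes. The part of the layer on [far n] tends to 0 in L^p by
    dominated convergence. *)
Lemma haar_layer_cvg_Lp k :
  cvg_Lp mu p (@summability.totally (dy_idx D k))
    (fun (A : {fset dy_idx D k}) x => \sum_(a <- A) haar_cube mu ch f a x)
    (haar_layer mu ch f k).
Proof.
have Ll := Lfun_haar_layer k; have ml := Lfun_measurable Ll.
have mA (A : {fset dy_idx D k}) :
    measurable_fun setT (fun x => \sum_(a <- A) haar_cube mu ch f a x).
  by apply: measurable_sum => a; exact: measurable_haar_cube.
split => // [A|].
  apply: (Lfun_le p1 (mA A) Ll) => x; rewrite haar_partial_sumE//.
  by case: ifP => // _; rewrite normr0.
pose far (n : nat) := [set x | (n <= choice.pickle (cube_at D k x))%N].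
have kfar n : dyadic_set D k (far n) by move=> x y xy; rewrite /far/= xy.
pose u n x := haar_layer mu ch f k x * \1_(far n) x.
have mu_ n : measurable_fun setT (u n).
  apply: measurable_funM => //; apply: measurable_indic.
  exact: measurable_dyadic_set (kfar n).
have u0 : N (u n) @[n --> \oo] --> 0%E.
  apply: (Lnorm_dominated p1 mu_ Ll) => [n x|].
    by rewrite /u indicE; case: (_ \in _); rewrite ?mulr1// mulr0 normr0.
  apply: aeW => x; apply: cvg_near_cst; near=> n.
  rewrite /u indicE memNset ?mulr0// /far/=; apply/negP; rewrite -ltnNge.
  by near: n; exact: nbhs_infty_gt.
apply: (@Lnorm_cvg0 _ _ _ mu p _ _ summability.totally_filter
  (fun A x => \sum_(a <- A) haar_cube mu ch f a x - haar_layer mu ch f k x)).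
move=> e e0; have [n _ /(_ n (leqnn n)) un] := Lnorm_cvg0_le e0 u0.
exists [fset a in pmap (@pickle_inv (dy_idx D k)) (iota 0 n)]%fset => // A /= nA.
apply: le_trans un; apply: le_Lnorm => //; first exact: measurable_funB.
move=> x; rewrite haar_partial_sumE//.
case: ifPn => xA; first by rewrite subrr normr0.
rewrite sub0r normrN /u indicE mem_set ?mulr1// /far/= leqNgt.
apply: contra xA => xn; apply: (fsubsetP nA).
rewrite inE/= mem_pmap; apply/mapP; exists (choice.pickle (cube_at D k x)).
  by rewrite mem_iota.
by rewrite pickleK_inv.
Unshelve. all: by end_near. Qed.

End haar_expansion.

(** * Reduction of the Haar expansion to the convergence of means *)

Theorem theorem4p9 (R : realType) (d : measure_display) (X : measurableType d)
    (rho : X -> X -> R) (mu : {measure set X -> \bar R})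
    (D : dyadic_system rho)
    (ch : forall k : int, dy_idx D k -> nat -> dy_idx D (k + 1))
    (rho_qmetric : quasi_metric rho)
    (rho_doubling : geometrically_doubling rho)
    (X_borel : borel_space rho)
    (mu_ball : forall x r, (mu (qball rho x r) < +oo)%E)
    (D_center : distinguished_center_point D)
    (ch_ordering : haar_ordering mu ch)
    (p : R) (p_gt1 : 1 < p)
    (f : X -> R) (f_Lp : f \in Lfun mu p%:E) :
  (* the sum over the cubes of each generation converges in Lp *)
  (forall k : int,
     cvg_Lp mu p (@summability.totally (dy_idx D k))
       (fun (A : {fset dy_idx D k}) x => \sum_(a <- A) haar_cube mu ch f a x)
       (haar_layer mu ch f k)) /\
  (* f = first sum + second sum *)
  (forall m : int,
     {ae mu, forall x,
        series (fun i : nat => haar_layer mu ch f (m + i%:Z) x) @ \oo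
          --> f x - haar_average mu ch f m x} /\
     cvg_Lp mu p \oo
       (fun n x => series (fun i : nat => haar_layer mu ch f (m + i%:Z) x) n)
       (fun x => f x - haar_average mu ch f m x)) /\
  (* the second sum as m tends to -oo *)
  (mu setT = +oo%E -> forall x,
     haar_average mu ch f (- n%:Z) x @[n --> \oo] --> 0) /\
  ((mu setT < +oo)%E -> forall x,
     haar_average mu ch f (- n%:Z) x @[n --> \oo]
       --> (fine (mu setT))^-1 * \int[mu]_y f y) /\
  cvg_Lp mu p \oo (fun n : nat => haar_average mu ch f (- n%:Z))
    (cst (space_mean mu f)) /\
  (* the two-sided expansion: n.1 and n.2 tend to +oo independently *)
  {ae mu, forall x,
     space_mean mu f
       + \sum_(0 <= i < (n.1 + n.2)%N) haar_layer mu ch f (i%:Z - n.1%:Z) x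
       @[n --> filter_prod \oo \oo] --> f x} /\
  cvg_Lp mu p (filter_prod \oo \oo)
    (fun (n : nat * nat) x => space_mean mu f
       + \sum_(0 <= i < (n.1 + n.2)%N) haar_layer mu ch f (i%:Z - n.1%:Z) x)
    f.
Proof.
have p1 : 1 <= p by exact: ltW.
have cube_fin k (a : dy_idx D k) : (mu (dy_cube a) < +oo)%E.
  apply: le_lt_trans (mu_ball (dy_center a) (dy_C1 D * dy_delta D ^ k)).
  apply: le_measure; rewrite ?inE; [exact: dy_measurable| |exact: dy_sub_ball].
  by case: X_borel => _; exact.
have f_int k (a : dy_idx D k) : mu.-integrable (dy_cube a) (EFin \o f).
  by apply: (Lfun_loc_int p1 f_Lp) => //; exact: dy_measurable.
(* From here on every assertion about the second sum is one about means over cubes. *)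
have -> : haar_average mu ch f = condexp D mu ^~ f.
  by apply/funext => k; apply/funext => x; rewrite haar_averageE.
have [x0 x0_cover] := coarse_cubes_cover D_center.
have Ef k := Lfun_condexp cube_fin p_gt1 k f_Lp.
have mE k := Lfun_measurable (Ef k).
have mf := Lfun_measurable f_Lp.
have coarse x := condexp_coarse_cvg cube_fin x0_cover p_gt1 x f_Lp.
have coarseLp := condexp_coarse_Lp cube_fin x0_cover p_gt1 f_Lp.
have meanL : cst (space_mean mu f) \in Lfun mu p%:E.
  by have [] := Lp_contraction_space_mean p_gt1 f_Lp f_Lp.
have nonnull := ae_nonnull_cubes D mu.
have sumL m n := Lfun_haar_layer_sum cube_fin ch_ordering p_gt1 f_Lp m n.
split; first by move=> k; exact: haar_layer_cvg_Lp.
split.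
  move=> m; split.
    have := condexp_ae rho_qmetric X_borel cube_fin m p1 f_Lp.
    apply: filterS2 nonnull => x x0' fx.
    rewrite (_ : series _ = fun n => condexp D mu (m + n%:Z) f x - condexp D mu m f x).
      by apply: cvgB => //; exact: cvg_cst.
    by apply/funext => n; exact: (haar_layer_sum cube_fin ch_ordering p_gt1 f_Lp).
  split.
  - by move=> n; exact: sumL.
  - exact: LfunB.
  apply: cvg_trans (condexp_cvg_Lp rho_qmetric X_borel cube_fin p_gt1 m f_Lp).
  apply: near_eq_cvg; apply: nearW => n; apply: Lnorm_ae_eq.
  + exact: measurable_funB.
  + by apply: Lfun_measurable; apply: (LfunB p1 (sumL m n)); exact: LfunB.
  apply: filterS nonnull => x x0'.
  by rewrite /= [series _ _](haar_layer_sum cube_fin ch_ordering p_gt1 f_Lp)//; ring.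
split; first by move=> muT x; have := coarse x; rewrite space_mean_infty.
split; first by move=> muT x; have := coarse x; rewrite space_mean_fin.
split; first by split.
(* The layers from generation [- n.1] to [n.2 - 1] telescope. The [0 +] matches the form in which
   the fine limit is available, started at generation 0. *)
have partialE n x : (forall k, mu (dy_cube (cube_at D k x)) != 0%E) ->
    \sum_(0 <= i < (n.1 + n.2)%N) haar_layer mu ch f (i%:Z - n.1%:Z) x =
    condexp D mu (0 + n.2%:Z) f x - condexp D mu (- n.1%:Z) f x.
  move=> x0'; under eq_bigr do rewrite addrC.
  rewrite (haar_layer_sum cube_fin ch_ordering p_gt1 f_Lp)//.
  by rewrite PoszD addrA addNr.
have partialL n : (fun x =>
    \sum_(0 <= i < (n.1 + n.2)%N) haar_layer mu ch f (i%:Z - n.1%:Z) x)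
    \in Lfun mu p%:E.
  rewrite (_ : (fun x => _) = (fun x =>
      \sum_(0 <= i < (n.1 + n.2)%N) haar_layer mu ch f (- n.1%:Z + i%:Z) x)) //.
  by apply/funext => x; apply: eq_bigr => i _; rewrite addrC.
split.
  have := condexp_ae rho_qmetric X_borel cube_fin 0 p1 f_Lp.
  apply: filterS2 nonnull => x x0' fx.
  rewrite (_ : (fun n => _) = (fun n : nat * nat => space_mean mu f +
      (condexp D mu (0 + n.2%:Z) f x - condexp D mu (- n.1%:Z) f x))); last first.
    by apply/funext => n; rewrite partialE.
  (* This separates the fine limit, driven by [n.2] alone, from the coarse limit, driven by [n.1]
     alone. *)
  have -> : f x = space_mean mu f + (f x - space_mean mu f) by ring.
  apply: cvgD; first exact: cvg_cst.
  apply: cvgB.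
    exact: (cvg_comp _ _ cvg_snd fx).
  exact: (cvg_comp _ _ cvg_fst (coarse x)).
split => //; first by move=> n; exact: LfunD meanL (partialL n).
apply: (@Lnorm_cvg0 _ _ _ mu p _ _ _ (fun (n : nat * nat) x => space_mean mu f
  + \sum_(0 <= i < (n.1 + n.2)%N) haar_layer mu ch f (i%:Z - n.1%:Z) x - f x)).
move=> e e0; have e20 : 0 < e / 2 by rewrite divr_gt0.
have fineLp := condexp_cvg_Lp rho_qmetric X_borel cube_fin p_gt1 0 f_Lp.
have lo := @Lnorm_cvg0_le _ _ _ _ _ _ _ eventually_filter _ _ e20 coarseLp.
have hi := @Lnorm_cvg0_le _ _ _ _ _ _ _ eventually_filter _ _ e20 fineLp.
near=> n.
have mhi : measurable_fun setT (fun x => condexp D mu (0 + n.2%:Z) f x - f x).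
  exact: measurable_funB.
have mlo : measurable_fun setT (fun x => condexp D mu (- n.1%:Z) f x - space_mean mu f).
  exact: measurable_funB.
(* Almost everywhere the error is the fine error minus the coarse error, each of which is allotted
   [e / 2]. *)
rewrite (_ : Lnorm _ _ _ = 'N[mu]_p%:E[EFin \o (fun x =>
    (condexp D mu (0 + n.2%:Z) f x - f x) -
    (condexp D mu (- n.1%:Z) f x - space_mean mu f))%R])%E; last first.
  apply: Lnorm_ae_eq.
  + exact: Lfun_measurable (LfunB p1 (LfunD p1 meanL (partialL n)) f_Lp).
  + exact: measurable_funB.
  + by apply: filterS nonnull => x x0'; rewrite partialE//=; ring.
apply: le_trans (LnormB_le mu p1 mhi mlo) _.
rewrite [e]splitr EFinD; apply: leeD.
  by near: n; exact: (cvg_snd hi).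
by near: n; exact: (cvg_fst lo).
Unshelve. all: by end_near. Qed.
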